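(* Suppose that $r\in(1,\infty)$ and let $r'$ be the conjugate index. The following hold: (i) for every $f\in BMO^{r'}(\mu)$ the functional $\ell$, initially defined on $H^{1,r}_{\mathrm{fin}}(\mu)$ by the rule $$\ell(g)=\int_M f\,g\,d\mu,$$ extends to a bounded functional on $H^{1,r}(\mu)$. Furthermore, the norm of $\ell$ as a functional on $H^{1,r}(\mu)$ is at most $\|f\|_{BMO^{r'}(\mu)}$; (ii) there exists a constant $C$ such that for every continuous linear functional $\ell$ on $H^{1,r}(\mu)$ there exists a function $f^\ell\in BMO^{r'}(\mu)$ such that $\|f^\ell\|_{BMO^{r'}(\mu)}\le C\,\|\ell\|_{H^{1,r}(\mu)^*}$ and $$\ell(g)=\int_M f^\ell\,g\,d\mu\qquad\text{for all } g\in H^{1,r}_{\mathrm{fin}}(\mu).$$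
   Context: Setting. $(M,\rho,\mu)$ is a metric measure space ($\mu$ a Borel measure), $M$ is unbounded, $\mu(M)>0$ and every ball has finite measure. $\mathcal{B}$ is the family of all balls of $M$; $c_B$, $r_B$ are the centre and radius of $B\in\mathcal{B}$, $\kappa B$ is the ball with centre $c_B$ and radius $\kappa r_B$; for $b>0$, $\mathcal{B}_b$ is the family of balls with $r_B\le b$. For $A\subset M$ and $\kappa>0$, $A_\kappa=\{x\in A:\rho(x,A^c)\le\kappa\}$. It is assumed that $M$ has the following three properties. Local doubling property (LDP): for every $b>0$ there is a constant $D_b$ such that $\mu(2B)\le D_b\,\mu(B)$ for all $B\in\mathcal{B}_b$. Isoperimetric property (I): there exist $\kappa_0,C>0$ such that for every bounded open set $A$, $\mu(A_\kappa)\ge C\kappa\,\mu(A)$ for all $\kappa\in(0,\kappa_0]$. Approximate midpoint property (AMP): there exist $R_0\in[0,\infty)$ and $\beta\in(1/2,1)$ such that for every pair of points $x,y\in M$ with $\rho(x,y)>R_0$ there is a ball $B$ containing $x$ and $y$ with $r_B<\beta\,\rho(x,y)$. The constants $R_0,\beta$ are fixed. A constant $b_0>R_0/(1-\beta)$ is fixed. Atoms. For $r\in(1,\infty)$, a $(1,r)$-atom $a$ is a function in $L^1(\mu)$ supported in a ball $B\in\mathcal{B}$ with $\int_B a\,d\mu=0$ and $\bigl(\frac1{\mu(B)}\int_B|a|^r\,d\mu\bigr)^{1/r}\le\mu(B)^{-1}$. Hardy space. For $b>0$, $H_b^{1,r}(\mu)$ is the space of all $g\in L^1(\mu)$ admitting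 a decomposition $g=\sum_{k=1}^\infty\lambda_k a_k$, where each $a_k$ is a $(1,r)$-atom supported in a ball of $\mathcal{B}_b$ and $\sum_k|\lambda_k|<\infty$; $\|g\|_{H_b^{1,r}(\mu)}$ is the infimum of $\sum_k|\lambda_k|$ over all such decompositions. For $b>R_0/(1-\beta)$ all these spaces coincide, with equivalent norms; the common space is $H^{1,r}(\mu)$, here normed by $\|\cdot\|_{H_{b_0}^{1,r}(\mu)}$. $H^{1,r}_{\mathrm{fin}}(\mu)$ is the (dense) subspace of finite linear combinations of $(1,r)$-atoms. BMO. For $q\in[1,\infty)$, $b>0$ and a locally integrable function $f$ put $N_b^q(f)=\sup_{B\in\mathcal{B}_b}\bigl(\frac1{\mu(B)}\int_B|f-f_B|^q\,d\mu\bigr)^{1/q}$, where $f_B$ is the average of $f$ over $B$. $BMO^q(\mu)$ is the space of equivalence classes modulo constants of locally integrable $f$ with $N_{b_0}^q(f)<\infty$, here normed by $\|f\|_{BMO^q(\mu)}=N_{b_0}^q(f)$ (the norms $N^q_b$, $b>R_0/(1-\beta)$, are all equivalent). *)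

(* Defs.v *)
From HB Require Import structures.
From mathcomp Require Import all_boot all_order all_algebra.
From mathcomp Require Import all_classical all_reals all_analysis.

Set Implicit Arguments.
Unset Strict Implicit.
Unset Printing Implicit Defensive.

Import Order.TTheory GRing.Theory Num.Theory.
Import numFieldNormedType.Exports.

Local Open Scope classical_set_scope.
Local Open Scope ring_scope.

(* A metric space carrying its Borel sigma-algebra.  The base point that
   MathComp-Analysis requires of measurable types is harmless here: spaces of
   positive measure are nonempty. *)
HB.mixin Record isBorelMetric (d : measure_display) (K : numDomainType) T
    & Measurable d T & Metric K T := {
  borel_measurableE : (measurable : set (set T)) = <<s open >>
}.

#[short(type="borelMetricType")]
HB.structure Definition BorelMetric (d : measure_display) (K : numDomainType) :=
  { T of Measurable d T & Metric K T & isBorelMetric d K T }.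

Section geometry.
Context {d : measure_display} {R : realType} {M : borelMetricType d R}.
Variable mu : {measure set M -> \bar R}.

Definition metric_bounded (A : set M) : Prop :=
  exists (c : M) (s : R), A `<=` ball c s.

(* The part of A at distance at most k from the complement of A;
   the distance to the empty set is +oo. *)
Definition inner_collar (A : set M) (k : R) : set M :=
  [set x | A x /\ (edist_inf (~` A) x <= k%:E)%E].

Definition local_doubling : Prop :=
  forall b : R, 0 < b -> exists D : R, forall (c : M) (s : R), 0 < s <= b ->
    (mu (ball c (2 * s)) <= D%:E * mu (ball c s))%E.

Definition isoperimetric : Prop :=
  exists k0 C : R, [/\ 0 < k0, 0 < C &
    forall A : set M, open A -> metric_bounded A ->
    forall k : R, 0 < k <= k0 ->
      ((C * k)%:E * mu A <= mu (inner_collar A k))%E].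

End geometry.

Definition approx_midpoint {d : measure_display} {R : realType}
    (M : borelMetricType d R) (R0 beta : R) : Prop :=
  forall x y : M, R0 < mdist x y ->
    exists (c : M) (s : R), [/\ ball c s x, ball c s y & s < beta * mdist x y].

Section averages.
Context {d : measure_display} {R : realType} {M : borelMetricType d R}.
Variable mu : {measure set M -> \bar R}.

Definition average (B : set M) (f : M -> R) : R :=
  (fine (mu B))^-1 * \int[mu]_(x in B) f x.

Definition Lq_mean (q : R) (B : set M) (f : M -> R) : \bar R :=
  ((((fine (mu B))^-1)%:E * \int[mu]_(x in B) (`|f x| `^ q)%:E) `^ q^-1)%E.

End averages.

(* Elements of L^1, H^1 and BMO are represented by functions M -> R: nothing
   below distinguishes measurable functions that agree almost everywhere.
   Balls are open, and are given with a centre c and a radius s > 0, since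
   these need not be determined by the underlying set. *)

Section hardy.
Context {d : measure_display} {R : realType} {M : borelMetricType d R}.
Variable mu : {measure set M -> \bar R}.

Definition atom_on (r : R) (B : set M) (a : M -> R) : Prop :=
  [/\ mu.-integrable setT (EFin \o a),
      {ae mu, forall x, ~ B x -> a x = 0},
      \int[mu]_(x in B) a x = 0 &
      (Lq_mean mu r B a <= ((fine (mu B))^-1)%:E)%E].

Definition atom (r : R) (a : M -> R) : Prop :=
  exists (c : M) (s : R), 0 < s /\ atom_on r (ball c s) a.

Definition atom_le (b r : R) (a : M -> R) : Prop :=
  exists (c : M) (s : R), 0 < s <= b /\ atom_on r (ball c s) a.

(* g = \sum_k lam k * a k, the series converging in L^1. *)
Definition atomic_decomposition (b r : R) (g : M -> R)
    (lam : nat -> R) (a : nat -> M -> R) : Prop :=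
  [/\ forall k, atom_le b r (a k),
      (\sum_(0 <= k <oo) (`|lam k|)%:E < +oo)%E &
      (fun n => \int[mu]_x (`|g x - \sum_(k < n) lam k * a k x|)%:E)%E
        @ \oo --> 0%E].

Definition hardy (b r : R) : set (M -> R) :=
  [set g | mu.-integrable setT (EFin \o g) /\
           exists lam a, atomic_decomposition b r g lam a].

Definition hardy_norm (b r : R) (g : M -> R) : \bar R :=
  ereal_inf [set t | exists lam a, atomic_decomposition b r g lam a /\
                                   t = (\sum_(0 <= k <oo) (`|lam k|)%:E)%E].

Definition hardy_fin (r : R) : set (M -> R) :=
  [set g | exists (n : nat) (lam : 'I_n -> R) (a : 'I_n -> M -> R),
     (forall i, atom r (a i)) /\ forall x, g x = \sum_(i < n) lam i * a i x].

End hardy.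

(* Functionals on hardy mu b r are total functions on M -> R, of which only the
   values on hardy mu b r are considered. *)

Section dual.
Context {d : measure_display} {R : realType} {M : borelMetricType d R}.
Variables (mu : {measure set M -> \bar R}) (b r : R).
Implicit Type l : (M -> R) -> R.

Definition hardy_linear l : Prop :=
  (forall g h, hardy mu b r g -> hardy mu b r h ->
     {ae mu, forall x, g x = h x} -> l g = l h) /\
  (forall (t : R) g h, hardy mu b r g -> hardy mu b r h ->
     l (fun x => t * g x + h x) = t * l g + l h).

Definition hardy_bounded l : Prop :=
  exists K : R, forall g, hardy mu b r g ->
    ((`|l g|)%:E <= K%:E * hardy_norm mu b r g)%E.

Definition hardy_continuous l : Prop :=
  forall g, hardy mu b r g -> forall e : R, 0 < e ->
  exists2 dl : R, 0 < dl & forall h, hardy mu b r h ->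
    (hardy_norm mu b r (fun x => h x - g x)%R < dl%:E)%E -> `|l h - l g| < e.

Definition dual_norm l : \bar R :=
  ereal_sup [set (`|l g|)%:E |
             g in [set g | hardy mu b r g /\ (hardy_norm mu b r g <= 1)%E]].

End dual.

Section bmo.
Context {d : measure_display} {R : realType} {M : borelMetricType d R}.
Variable mu : {measure set M -> \bar R}.

(* Closed bounded sets need not be compact, so local integrability is read as
   integrability on balls, which is what makes the averages meaningful. *)
Definition locally_integrable_balls (f : M -> R) : Prop :=
  forall (c : M) (s : R), 0 < s -> mu.-integrable (ball c s) (EFin \o f).

Definition bmo_norm (b q : R) (f : M -> R) : \bar R :=
  ereal_sup [set t | exists (c : M) (s : R), 0 < s <= b /\
    t = Lq_mean mu q (ball c s)
          (fun x => f x - average mu (ball c s) f)].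

Definition bmo (b q : R) : set (M -> R) :=
  [set f | locally_integrable_balls f /\ (bmo_norm b q f < +oo)%E].

End bmo.

(* Main.v *)
Require Import Defs.
From HB Require Import structures.
From mathcomp Require Import all_boot all_order all_algebra.
From mathcomp Require Import all_classical all_reals all_analysis.
From mathcomp Require Import measurable_realfun lra.
Import Order.TTheory GRing.Theory Num.Theory.
Import numFieldNormedType.Exports.
Local Open Scope classical_set_scope.
Local Open Scope ring_scope.

(** For (i), truncate f at height n: truncation is 1-Lipschitz, so the pairing
    of the truncated f with an atom a on a ball B is at most the integral of
    |f - f_B| |a| over B, hence at most the BMO norm of f, uniformly in n. Since
    the truncations are bounded, these pairings can be summed along any atomic
    decomposition, and their limit in n along an ultrafilter is a functional of
    norm at most the BMO norm of f.

    For (ii), the doubling property makes balls totally bounded, and approximate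
    midpoints join any two points by a chain with steps smaller than b0. Thus
    every mean-zero L^r function u with bounded support is a finite combination
    of atoms on b0-balls with coefficients controlled by the L^r norm of u.
    Fixing a small ball B0, the map u |-> l (u - (int u) 1_B0 / mu(B0)) is
    therefore a bounded functional on L^r of every ball, and the Riesz
    representation theorem (Radon-Nikodym and converse Hoelder) on an exhaustion
    by balls yields f. Converse Hoelder on a ball of radius at most b0 bounds the
    mean oscillation of f by twice the norm of l. *)

(** For g in H^1 the product f g need not be integrable, and a bound on single atoms does not by
    itself make the sum of [lam k] times the pairing of f with [a k] independent of the
    decomposition. A bounded f has neither defect, because its pairing is continuous in L^1; this is
    why f is truncated and why the bounds must be free of the height. In (ii) the functional is
    controlled only through atoms on b0-balls, while the test functions live on arbitrarily large
    balls. The cover and the chains bridge this gap with constants that may grow with the ball. This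
    is harmless, since they only make the Riesz theorem applicable on each ball: the BMO bound is
    read off afterwards from single b0-balls, where a mean-zero function is a multiple of one atom.
    The factor 2 is the price of replacing u by u - (int u) 1_B / mu(B), which at most doubles the
    L^r norm. The choice of B0 fixes f among the functions that differ from it by a constant. *)

Set Implicit Arguments.
Unset Strict Implicit.
Unset Printing Implicit Defensive.

(** * Norms on L^r *)

Section Lr.
Context {d : measure_display} {T : measurableType d} {R : realType}.
Variable mu : {measure set T -> \bar R}.
Implicit Types (p q : R) (u v f g h : T -> R) (A D : set T).

(** Real-valued, so that estimates can be done in [R]. It is the L^p norm only for members of
    [Lfun]: [fine] sends an infinite norm to 0. *)
Definition Lrnorm p u : R := fine ('N[mu]_p%:E[EFin \o u])%E.

Lemma Lfun_intP p u : 0 < p ->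
  u \in Lfun mu p%:E <->
  measurable_fun setT u /\ (\int[mu]_x (`|u x| `^ p)%:E < +oo)%E.
Proof.
move=> p0; have pn0 : p != 0 by rewrite gt_eqF.
split=> [/andP[]|[mu' iu]].
  rewrite !inE/= => mu'; rewrite /finite_norm unlock => /lty_poweRy; rewrite invr_neq0//.
  by move=> /(_ isT) ?; split.
rewrite inE; apply/andP; rewrite !inE/=; split => //.
by rewrite /finite_norm unlock; apply: poweR_lty.
Qed.

Lemma Lfun_meas p u : u \in Lfun mu p%:E -> measurable_fun setT u.
Proof. by move=> /andP[]; rewrite inE. Qed.

Lemma Lrnorm_ge0 p u : 0 <= Lrnorm p u.
Proof. by rewrite fine_ge0// Lnorm_ge0. Qed.

Lemma LrnormE p u : u \in Lfun mu p%:E ->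
  (Lrnorm p u)%:E = ('N[mu]_p%:E[EFin \o u])%E.
Proof.
move=> /andP[_]; rewrite inE/= => fu; rewrite fineK// ge0_fin_numE//.
exact: Lnorm_ge0.
Qed.

Lemma Lrnorm_powR p u : 0 < p -> u \in Lfun mu p%:E ->
  ((Lrnorm p u) `^ p)%:E = (\int[mu]_x (`|u x| `^ p)%:E)%E.
Proof.
move=> p0 up; rewrite -poweR_EFin LrnormE// powR_Lnorm ?gt_eqF//.
Qed.

Lemma measurable_powR_norm p u A :
  measurable_fun A u -> measurable_fun A (fun x => `|u x| `^ p).
Proof.
move=> m; apply: (@measurableT_comp _ _ _ _ _ _ (@powR R ^~ p)) => //.
exact: measurableT_comp.
Qed.

Lemma Lfun_le p u v : 0 < p -> measurable_fun setT u ->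
  (forall x, `|u x| <= `|v x|) -> v \in Lfun mu p%:E ->
  u \in Lfun mu p%:E /\ Lrnorm p u <= Lrnorm p v.
Proof.
move=> p0 mf uv vp; have [mv iv] := (Lfun_intP v p0).1 vp.
have le : (\int[mu]_x (`|u x| `^ p)%:E <= \int[mu]_x (`|v x| `^ p)%:E)%E.
  apply: ge0_le_integral => //.
  - exact/measurable_EFinP/measurable_powR_norm.
  - exact/measurable_EFinP/measurable_powR_norm.
  - by move=> x _; rewrite lee_fin ge0_ler_powR// ?nnegrE ?normr_ge0// ltW.
have up : u \in Lfun mu p%:E.
  by apply: (Lfun_intP u p0).2; split; [exact: mf|exact: le_lt_trans le iv].
split => //; rewrite -(@ler_pXn2r _ 1)// ?nnegrE ?Lrnorm_ge0// !expr1.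
rewrite -[leLHS](@powRr1)// ?Lrnorm_ge0// -[leRHS](@powRr1)// ?Lrnorm_ge0//.
(* Writing the exponent 1 as [p * p^-1] reduces the inequality of norms to that of the integrals of
   p-th powers. *)
rewrite -(mulfV (lt0r_neq0 p0)) !powRrM.
rewrite ge0_ler_powR ?invr_ge0 ?(ltW p0) ?nnegrE ?powR_ge0//.
by rewrite -lee_fin !Lrnorm_powR.
Qed.

Lemma measurable_restr A u : measurable A -> measurable_fun setT u ->
  measurable_fun setT (u \_ A).
Proof.
move=> mA mu'; apply/(measurable_restrictT _ mA).
exact: measurable_funS mu'.
Qed.

Lemma Lfun_restr p A u : 0 < p -> measurable A -> u \in Lfun mu p%:E ->
  u \_ A \in Lfun mu p%:E /\ Lrnorm p (u \_ A) <= Lrnorm p u.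
Proof.
move=> p0 mA up; apply: Lfun_le => //.
  exact/measurable_restr/(Lfun_meas up).
by move=> x; rewrite patchE; case: ifP; rewrite ?normr0.
Qed.

Lemma Lfun_lin p (t : R) u v : 1 <= p ->
  u \in Lfun mu p%:E -> v \in Lfun mu p%:E ->
  (fun x => t * u x + v x) \in Lfun mu p%:E /\
  Lrnorm p (fun x => t * u x + v x) <= `|t| * Lrnorm p u + Lrnorm p v.
Proof.
move=> p1 up vp; have p1' : (1 <= p%:E)%E by rewrite lee_fin.
have tu : (t \*: (u : T -> R^o)) \in Lfun mu p%:E.
  have [_ L] := @Lfun_submod_closed _ _ _ mu _ p1'.
  have := L t u 0; rewrite addr0; apply => //.
  by have [] := @Lfun_submod_closed _ _ _ mu _ p1'.
have in_ : (fun x => t * u x + v x) \in Lfun mu p%:E.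
  have [_ L] := @Lfun_submod_closed _ _ _ mu _ p1'.
  exact: (L t u v).
split => //; rewrite -lee_fin EFinD EFinM !LrnormE//.
have := @LnormZ _ _ _ mu _ p1' (Lfun_Sub p1' up) t; rewrite Lfun_valP => <-.
apply: (@eminkowski _ _ _ mu (fun x => t * u x) v p%:E) => //.
- exact: (Lfun_meas tu).
- exact: Lfun_meas vp.
Qed.

Lemma Lfun0 p : 0 < p -> (fun=> 0 : R) \in Lfun mu p%:E /\ Lrnorm p (fun=> 0) = 0.
Proof.
move=> p0; have p0' : p%:E != 0%E by rewrite eqe gt_eqF.
have e : ('N[mu]_p%:E[EFin \o (fun=> 0%R)] = 0)%E.
  by rewrite -[RHS](@Lnorm0 _ _ _ mu _ p0').
split; last by rewrite /Lrnorm e.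
by rewrite inE; apply/andP; rewrite !inE/=; split => //; rewrite /finite_norm e.
Qed.

Lemma Lfun_Z p (t : R) u : 1 <= p -> u \in Lfun mu p%:E ->
  (fun x => t * u x) \in Lfun mu p%:E /\
  Lrnorm p (fun x => t * u x) <= `|t| * Lrnorm p u.
Proof.
move=> p1 up; have [z1 z2] := @Lfun0 p (lt_le_trans ltr01 p1).
have [+ +] := Lfun_lin t p1 up z1; rewrite z2 addr0.
by under eq_fun do rewrite addr0.
Qed.

Lemma Lfun_sum p (I : Type) (s : seq I) (u : I -> T -> R) : 1 <= p ->
  (forall i, u i \in Lfun mu p%:E) ->
  (fun x => \sum_(i <- s) u i x) \in Lfun mu p%:E.
Proof.
move=> p1 up; elim: s => [|i s IH].
  under eq_fun do rewrite big_nil.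
  exact: (Lfun0 (lt_le_trans ltr01 p1)).1.
under eq_fun do rewrite big_cons -[u i _]mul1r.
exact: (Lfun_lin 1 p1 (up i) IH).1.
Qed.

Lemma Lfun_indic p A : 0 < p -> measurable A -> (mu A < +oo)%E ->
  (\1_A : T -> R) \in Lfun mu p%:E /\
  Lrnorm p \1_A = (fine (mu A)) `^ p^-1.
Proof.
move=> p0 mA Aoo.
have e : (\int[mu]_x (`|\1_A x| `^ p)%:E = mu A)%E.
  rewrite -[in RHS](setIT A) -integral_indic//; apply: eq_integral => x _.
  rewrite indicE; case: (x \in A); rewrite ?normr1 ?powR1// normr0 powR0//.
  by rewrite gt_eqF.
split; last by rewrite /Lrnorm unlock -fine_poweR; congr (fine (_ `^ _)%E).
by apply: (Lfun_intP _ p0).2; rewrite e.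
Qed.

Lemma bounded_Lfun p A u (k : R) : 0 < p -> measurable A -> (mu A < +oo)%E ->
  measurable_fun setT u -> (forall x, `|u x| <= k) -> (forall x, ~ A x -> u x = 0) ->
  u \in Lfun mu p%:E.
Proof.
move=> p0 mA Aoo mf uk u0.
apply: (Lfun_intP _ p0).2; split => //.
apply: (@le_lt_trans _ _ (\int[mu]_(x in A) (k `^ p)%:E)%E); last first.
  by rewrite integral_cst//= lte_mul_pinfty ?lee_fin ?powR_ge0.
rewrite [leRHS]integral_mkcond; apply: ge0_le_integral => //.
- exact/measurable_EFinP/measurable_powR_norm.
- apply/(measurable_restrictT _ mA); exact: measurable_cst.
- move=> x _; rewrite patchE; case: ifPn => [_|/negP Ax].
    rewrite lee_fin ge0_ler_powR ?(ltW p0)// ?nnegrE//.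
    exact: le_trans (uk x).
  by rewrite u0 ?normr0 ?powR0 ?gt_eqF// => /mem_set.
Qed.

Lemma hoelder_int p q u v : 0 < p -> 0 < q -> p^-1 + q^-1 = 1 ->
  u \in Lfun mu p%:E -> v \in Lfun mu q%:E ->
  mu.-integrable setT (EFin \o (fun x => u x * v x)) /\
  \int[mu]_x `|u x * v x| <= Lrnorm p u * Lrnorm q v.
Proof.
move=> p0 q0 pq up vq.
have mf := Lfun_meas up; have mv := Lfun_meas vq.
have := hoelder mu mf mv p0 q0 pq; rewrite Lnorm1 -!LrnormE// -EFinM => H.
have iuv : mu.-integrable setT (EFin \o (fun x => u x * v x)).
  apply/integrableP; split; first exact/measurable_EFinP/measurable_funM.
  exact: le_lt_trans H (ltry _).
split => //; rewrite -lee_fin; apply: le_trans H.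
rewrite /Rintegral fineK//.
by have := integrable_fin_num measurableT (integrable_norm iuv).
Qed.

Lemma hoelder_Rint p q u v : 0 < p -> 0 < q -> p^-1 + q^-1 = 1 ->
  u \in Lfun mu p%:E -> v \in Lfun mu q%:E ->
  `|\int[mu]_x (u x * v x)| <= Lrnorm p u * Lrnorm q v.
Proof.
move=> p0 q0 pq up vq; have [iuv le] := hoelder_int p0 q0 pq up vq.
exact: le_trans (le_normr_Rintegral measurableT iuv) le.
Qed.

Lemma hoelder_set p q u A : 0 < p -> 0 < q -> p^-1 + q^-1 = 1 ->
  measurable A -> (mu A < +oo)%E -> u \in Lfun mu p%:E ->
  mu.-integrable A (EFin \o u) /\
  `|\int[mu]_(x in A) u x| <= Lrnorm p u * (fine (mu A)) `^ q^-1.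
Proof.
move=> p0 q0 pq mA Aoo up.
have [i1 i2] := Lfun_indic q0 mA Aoo.
have [iuv _] := hoelder_int p0 q0 pq up i1.
have e : (fun x => u x * \1_A x) = u \_ A.
  by apply/funext => x; rewrite patchE indicE; case: (x \in A); rewrite ?mulr1 ?mulr0.
split.
  by apply/(integrable_mkcond _ mA); rewrite restrict_EFin -e.
by rewrite Rintegral_mkcond -e -i2; exact: hoelder_Rint.
Qed.

End Lr.

(** * The converse of Hoelder's inequality on a set of finite measure *)

Section converse_hoelder.
Context {d : measure_display} {T : measurableType d} {R : realType}.
Variable mu : {measure set T -> \bar R}.

Import HBNNSimple.

Lemma nnsfun_nd_cvg (f : T -> R) : measurable_fun setT f -> (forall x, 0 <= f x) ->
  exists g : {nnsfun T >-> R}^nat,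
    [/\ (forall n x, g n x <= f x),
        (forall x, {homo (fun n => g n x) : m n / (m <= n)%N >-> m <= n}) &
        forall x, g n x @[n --> \oo] --> f x].
Proof.
move=> mf f0.
have mf' : measurable_fun setT (EFin \o f) by exact/measurable_EFinP.
have [|g [ndg gf]] := approximation measurableT mf'.
  by move=> x _; rewrite lee_fin.
have nd x : {homo (fun n => g n x) : m n / (m <= n)%N >-> m <= n}.
  by move=> m n mn; exact/lefP/ndg.
have gf' x : g n x @[n --> \oo] --> f x by have /fine_cvgP[_] := gf x I.
exists g; split => // n x; rewrite -(cvg_lim _ (gf' x))//.
by apply: (@nondecreasing_cvgn_le _ (fun n => g n x)) => //; apply: cvgP (gf' x).
Qed.

Lemma nnsfun_ubound (g : {nnsfun T >-> R}) : exists k, forall x, `|g x| <= k.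
Proof.
have [k [_ gk]] := simple_bounded g; exists (k + 1) => x.
by apply: gk => //; rewrite ltrDl.
Qed.

Lemma conjugate_gt1 (r r' : R) : 1 < r -> r^-1 + r'^-1 = 1 -> 1 < r'.
Proof.
move=> r1 rr'; have r0 : 0 < r := lt_trans ltr01 r1.
have r'i : r'^-1 = 1 - r^-1 by rewrite -rr' addrC addKr.
have ri1 : r^-1 < 1 by rewrite invf_lt1.
have ri0 : 0 < r^-1 by rewrite invr_gt0.
have r'0 : 0 < r' by rewrite -invr_gt0 r'i subr_gt0.
by rewrite -invf_lt1// r'i; lra.
Qed.

Lemma conjugate_mul (r r' : R) : 1 < r -> r^-1 + r'^-1 = 1 -> r * r' = r + r'.
Proof.
move=> r1 rr'; have r'1 := conjugate_gt1 r1 rr'.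
have rn : r != 0 by rewrite gt_eqF// (lt_trans ltr01).
have rn' : r' != 0 by rewrite gt_eqF// (lt_trans ltr01).
by rewrite -[LHS]mulr1 -rr' mulrDr mulrAC mulfV ?mul1r ?mulfK ?rn' 1?addrC.
Qed.

(* Testing against u = sgn h * phi for bounded 0 <= phi <= |h|^(r'-1) suffices,
   because phi^r <= |h| phi. *)
Lemma converse_hoelder (r r' K : R) (D : set T) (h : T -> R) :
  1 < r -> r^-1 + r'^-1 = 1 -> measurable D -> (mu D < +oo)%E ->
  measurable_fun setT h -> mu.-integrable D (EFin \o h) -> 0 <= K ->
  (forall u : T -> R, u \in Lfun mu r%:E -> (forall x, ~ D x -> u x = 0) ->
     mu.-integrable D (EFin \o (fun x => h x * u x)) ->
     `|\int[mu]_(x in D) (h x * u x)| <= K * Lrnorm mu r u) ->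
  (\int[mu]_(x in D) (`|h x| `^ r')%:E <= (K `^ r')%:E)%E.
Proof.
move=> r1 rr' mD Doo mh ih K0 H.
have r0 : 0 < r := lt_trans ltr01 r1.
have r'1 := conjugate_gt1 r1 rr'; have r'0 : 0 < r' := lt_trans ltr01 r'1.
have rr'M := conjugate_mul r1 rr'.
pose w x := `|h x| `^ r'.
have mw : measurable_fun setT w by exact: measurable_powR_norm.
have [|s [sle snd scvg]] := nnsfun_nd_cvg mw; first by move=> x; exact: powR_ge0.
(* With [g n] the r-th root of a simple approximation of [|h|^r'], the r-th power of the L^r norm of
   the test function is exactly the integral of [s n] over [D]. *)
pose g n x := (s n x) `^ r^-1.
have g_ge0 n x : 0 <= g n x by exact: powR_ge0.
have gr n x : g n x `^ r = s n x.
  by rewrite /g -powRrM mulVf ?powRr1// gt_eqF.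
have gle n x : g n x <= `|h x| `^ (r' - 1).
  have -> : r' - 1 = r' * r^-1.
    by apply: (mulIf (lt0r_neq0 r0)); rewrite mulfVK ?gt_eqF//; lra.
  by rewrite powRrM /g ge0_ler_powR ?nnegrE ?invr_ge0 ?(ltW r0) ?powR_ge0.
have mg n : measurable_fun setT (g n).
  have := @measurable_powR_norm _ _ _ r^-1 (s n) setT.
  under eq_fun do rewrite ger0_norm//.
  by apply; exact: measurable_funP.
have step n : (\int[mu]_(x in D) (s n x)%:E <= (K `^ r')%:E)%E.
  have [k0 sk] := nnsfun_ubound (s n).
  pose k := k0 `^ r^-1.
  have gk x : g n x <= k.
    have k00 : s n x <= k0 by rewrite -[leLHS]ger0_norm.
    rewrite ge0_ler_powR ?nnegrE ?invr_ge0 ?(ltW r0)//.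
    exact: le_trans k00.
  pose u := (fun x => if 0 <= h x then g n x else - g n x) \_ D.
  have mu' : measurable_fun setT u.
    apply: measurable_restr => //; apply: measurable_fun_ifT => //.
      exact: measurable_fun_ler.
    exact: measurableT_comp.
  have u0 x : ~ D x -> u x = 0 by move=> Dx; rewrite /u patchE memNset.
  have uabs x : `|u x| = g n x * (\1_D x).
    rewrite /u patchE indicE; case: (x \in D); rewrite ?mulr1 ?mulr0 ?normr0//.
    by case: ifP; rewrite ?normrN ger0_norm.
  have uk x : `|u x| <= k.
    rewrite uabs indicE; case: (x \in D); rewrite ?mulr1 ?mulr0.
      exact: gk.
    exact: le_trans (gk x).
  have uL : u \in Lfun mu r%:E by exact: (bounded_Lfun r0 mD Doo mu' uk u0).
  have ihu : mu.-integrable D (EFin \o (fun x => h x * u x)).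
    have := @integrableMl _ _ _ mu D mD (EFin \o h) u ih.
    apply; first exact: measurable_funTS.
    exists k; split; first exact: num_real.
    by move=> l kl x _ /=; exact: le_trans (uk x) (ltW kl).
  have := H u uL u0 ihu.
  set I := (\int[mu]_(x in D) (s n x)%:E)%E => Hu.
  have eI : ((Lrnorm mu r u) `^ r)%:E = I.
    rewrite Lrnorm_powR// /I [RHS]integral_mkcond; apply: eq_integral => x _.
    rewrite uabs patchE indicE; case: (x \in D); rewrite ?mulr1 ?gr//.
    by rewrite mulr0 powR0// gt_eqF.
  have le1 : Lrnorm mu r u `^ r <= K * Lrnorm mu r u.
    apply: le_trans Hu; rewrite -lee_fin eI.
    apply: le_trans (_ : _ <= (\int[mu]_(x in D) (h x * u x))%:E)%E _; last first.
      by rewrite lee_fin ler_norm.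
    rewrite /Rintegral fineK; last by apply: (integrable_fin_num mD ihu).
    apply: ge0_le_integral => //.
    - by move=> x _; rewrite lee_fin.
    - exact/measurable_EFinP/measurable_funTS/measurable_funP.
    - exact: measurable_int ihu.
    - move=> x Dx; rewrite lee_fin -gr /u patchE mem_set//.
      have -> : h x * (if 0 <= h x then g n x else - g n x) = `|h x| * g n x.
        by case: ltP => h0; [rewrite ltr0_norm// mulrN mulNr|rewrite ger0_norm].
      have [g0|g0] := eqVneq (g n x) 0; first by rewrite g0 powR0 ?mulr0// gt_eqF.
      have -> : r = (r - 1) + 1 by lra.
      rewrite powRD; last by apply/implyP => _.
      rewrite powRr1// ler_wpM2r//.
      have -> : `|h x| = (`|h x| `^ (r' - 1)) `^ (r - 1).
        rewrite -powRrM -[LHS]powRr1//; congr (_ `^ _); lra.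
      by rewrite ge0_ler_powR// ?nnegrE ?powR_ge0//; lra.
  rewrite -eI lee_fin; move: le1; set N := Lrnorm mu r u => le1.
  have N0 : 0 <= N by exact: Lrnorm_ge0.
  (* [N] is a true finite norm because [s n] is bounded and [D] has finite measure. Hence
     [N^r <= K N] may be divided by [N], and raising [N^(r-1) <= K] to the power [r'] gives the
     claim, as [(r-1) r' = r]. *)
  have [->|Nn] := eqVneq N 0; first by rewrite powR0 ?powR_ge0// gt_eqF.
  have Np : 0 < N by rewrite lt_neqAle eq_sym Nn.
  have le2 : N `^ (r - 1) <= K.
    rewrite -(ler_pM2r Np); apply: le_trans le1.
    by rewrite mulrC mulr_powRB1.
  have -> : N `^ r = (N `^ (r - 1)) `^ r'.
    by rewrite -powRrM; congr (_ `^ _); lra.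
  by rewrite ge0_ler_powR ?nnegrE ?powR_ge0// ltW.
have cv : (\int[mu]_(x in D) (s n x)%:E @[n --> \oo] -->
           \int[mu]_(x in D) (`|h x| `^ r')%:E)%E.
  have -> : (\int[mu]_(x in D) (`|h x| `^ r')%:E =
     \int[mu]_(x in D) limn (fun n => (s n x)%:E))%E.
    apply: eq_integral => x _; apply/esym/cvg_lim => //.
    by apply: cvg_EFin; [exact: nearW|exact: scvg].
  apply: cvg_monotone_convergence => //.
  - by move=> n; exact/measurable_EFinP/measurable_funTS/measurable_funP.
  - by move=> n x _; rewrite lee_fin.
  - by move=> x _ m n mn; rewrite lee_fin; exact: snd.
by apply: cvge_to_le cv _; exact: nearW.
Qed.

End converse_hoelder.

(** * The Riesz representation theorem for L^r *)

(** The charge and sigma-finite structures are built on the spot from the hypotheses, so that the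
    theorem applies to a bare set function [nu]. Taking [fine] of the density loses nothing, since
    it is finite at every point. *)
Lemma radon_nikodym_fun d (T : measurableType d) (R : realType)
    (mu : {measure set T -> \bar R}) (nu : set T -> \bar R) :
  sigma_finite setT mu -> nu set0 = 0%E ->
  (forall A, measurable A -> nu A \is a fin_num) ->
  semi_sigma_additive nu ->
  (forall A, measurable A -> mu A = 0%E -> nu A = 0%E) ->
  exists f : T -> R, mu.-integrable setT (EFin \o f) /\
    forall A, measurable A -> nu A = (\int[mu]_(x in A) (f x)%:E)%E.
Proof.
move=> sf nu0 nufin nuadd numu.
pose Hc := isCharge.Build _ _ _ nu nu0 nufin nuadd.
pose nu' : {charge set T -> \bar R} := HB.pack nu Hc.
pose Hf := isSFinite.Build _ _ _ _ (sfinite_measure_sigma_finite sf).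
pose Hs := isSigmaFinite.Build _ _ _ _ sf.
pose mu' := HB.pack_for (SigmaFiniteMeasure.type T R) (Measure.sort mu) Hf Hs.
have dom : nu' `<< mu'.
  apply/null_content_dominatesP => A mA A0; exact: numu.
exists (fine \o Radon_Nikodym nu' mu'); split.
  apply: eq_integrable (Radon_Nikodym_integrable dom) => // x _ /=.
  by rewrite fineK// Radon_Nikodym_fin_num.
move=> A mA; rewrite -[nu A]/(nu' A) (Radon_Nikodym_integral dom mA).
by apply: eq_integral => x _ /=; rewrite fineK// Radon_Nikodym_fin_num.
Qed.

Section functional_continuity.
Context {d : measure_display} {T : measurableType d} {R : realType}.
Variable mu : {measure set T -> \bar R}.

(** Dominated convergence for the r-th powers of the differences, with majorant [(2|u|)^r]. *)
Lemma dominated_Lrnorm_cvg0 (r : R) (u_ : (T -> R)^nat) (u : T -> R) :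
  1 <= r -> (forall n, measurable_fun setT (u_ n)) -> u \in Lfun mu r%:E ->
  (forall n x, `|u_ n x| <= `|u x|) -> (forall x, u_ n x @[n --> \oo] --> u x) ->
  Lrnorm mu r (fun x => u x - u_ n x) @[n --> \oo] --> 0.
Proof.
move=> r1 mu_ uL ule ucvg; have r0 : 0 < r := lt_le_trans ltr01 r1.
have muL := Lfun_meas uL.
have u_L n : (fun x => u x - u_ n x) \in Lfun mu r%:E.
  have [uLn _] := Lfun_le r0 (mu_ n) (ule n) uL.
  have [+ _] := Lfun_lin (-1) r1 uLn uL.
  by under eq_fun do rewrite mulN1r addrC.
pose g x := ((2 * `|u x|) `^ r)%:E.
have ig : mu.-integrable setT g.
  have [u2 _] := Lfun_Z 2 r1 uL.
  apply: eq_integrable (Lfun_integrable r1 u2) => // x _.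
  by rewrite /g normrM ger0_norm.
have mfn n : measurable_fun setT (fun x => (`|u x - u_ n x| `^ r)%:E).
  exact/measurable_EFinP/measurable_powR_norm/(Lfun_meas (u_L n)).
have cv0 x : (`|u x - u_ n x| `^ r)%:E @[n --> \oo] --> 0%E.
  apply: cvg_EFin; first exact: nearW.
  have c0 : `|u x - u_ n x| @[n --> \oo] --> 0.
    under eq_fun do rewrite distrC.
    exact/norm_cvg0P/subr_cvg0.
  (* Since [r >= 1], one has [t^r <= t] as soon as [0 <= t <= 1], so the powers are squeezed to
     0. *)
  apply: (@squeeze_cvgr _ _ _ _ (fun=> 0) (fun n => `|u x - u_ n x|)).
  - have /cvgrPdist_le /(_ _ ltr01) := c0.
    apply: filterS => n /=; rewrite sub0r normrN normr_id => le1.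
    rewrite powR_ge0/=; have [->|n0] := eqVneq `|u x - u_ n x| 0.
      by rewrite powR0// gt_eqF.
    by apply: ge1r_powR => //; rewrite le1 andbT lt_neqAle eq_sym n0 normr_ge0.
  - exact: cvg_cst.
  - exact: c0.
have leg n x : (`|(`|u x - u_ n x| `^ r)%:E| <= g x)%E.
  rewrite gee0_abs ?lee_fin ?powR_ge0// ge0_ler_powR ?nnegrE ?(ltW r0)// ?mulr_ge0//.
  by rewrite mulr_natl mulr2n (le_trans (ler_normB _ _))// lerD2l.
have [_ _] := @dominated_convergence _ _ _ mu _ measurableT
   (fun n x => (`|u x - u_ n x| `^ r)%:E) (cst 0%E) g mfn
   (measurable_cst _) (aeW _ (fun x _ => cv0 x)) ig
   (aeW _ (fun x n _ => leg n x)).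
rewrite integral0 => icv.
apply/cvgrPdist_lt => e e0.
have er : 0 < e `^ r by exact: powR_gt0.
have /fine_cvgP[_ /cvgrPdist_lt/(_ _ er)] : (\int[mu]_x (`|u x - u_ n x| `^ r)%:E)%E @[n --> \oo] --> (0:R)%:E.
  exact: icv.
apply: filterS => n /=; rewrite -Lrnorm_powR//= !sub0r !normrN.
rewrite !ger0_norm ?powR_ge0 ?Lrnorm_ge0//.
apply: contraTT; rewrite -!leNgt => le.
by rewrite ge0_ler_powR ?nnegrE ?Lrnorm_ge0 ?(ltW e0) ?(ltW r0).
Qed.

Variables (r K : R) (Lam : (T -> R) -> R).
Hypothesis r1 : 1 <= r.
Hypothesis Lam_lin : forall (t : R) u v,
  u \in Lfun mu r%:E -> v \in Lfun mu r%:E ->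
  Lam (fun x => t * u x + v x) = t * Lam u + Lam v.
Hypothesis Lam_bnd : forall u, u \in Lfun mu r%:E -> `|Lam u| <= K * Lrnorm mu r u.

Let r0 : 0 < r := lt_le_trans ltr01 r1.

(** Used twice: for the countable additivity of the set function given by [Lam] on indicators, and
    to pass from simple to nonnegative functions. *)
Lemma functional_dominated_cvg (u_ : (T -> R)^nat) (u : T -> R) :
  (forall n, measurable_fun setT (u_ n)) -> u \in Lfun mu r%:E ->
  (forall n x, `|u_ n x| <= `|u x|) -> (forall x, u_ n x @[n --> \oo] --> u x) ->
  Lam (u_ n) @[n --> \oo] --> Lam u.
Proof.
move=> mu_ uL ule ucvg.
have c0 := dominated_Lrnorm_cvg0 r1 mu_ uL ule ucvg.
have u_L n : u_ n \in Lfun mu r%:E := (Lfun_le r0 (mu_ n) (ule n) uL).1.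
apply/subr_cvg0/norm_cvg0P; under eq_fun do rewrite distrC.
have e n : Lam u - Lam (u_ n) = Lam (fun x => u x - u_ n x).
  have := Lam_lin (-1) (u_L n) uL; rewrite mulN1r addrC => <-.
  by congr Lam; apply/funext => x; rewrite mulN1r addrC.
under eq_fun do rewrite e.
apply: (@squeeze_cvgr _ _ _ _ (fun=> 0) (fun n => K * Lrnorm mu r (fun x => u x - u_ n x))).
- apply: nearW => n; rewrite normr_ge0/=; apply: Lam_bnd.
  have [+ _] := Lfun_lin (-1) r1 (u_L n) uL.
  by under eq_fun do rewrite mulN1r addrC.
- exact: cvg_cst.
- by rewrite -(mulr0 K); apply: cvgM => //; exact: cvg_cst.
Qed.

Lemma functional0 : Lam (fun=> 0) = 0.
Proof.
have [z _] := Lfun0 mu r0.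
have : Lam (fun=> 0) = 1 * Lam (fun=> 0) + Lam (fun=> 0).
  by rewrite -Lam_lin//; congr Lam; apply/funext => x; rewrite mulr0 addr0.
rewrite mul1r.
by move/eqP; rewrite eq_sym -subr_eq0 addrK => /eqP.
Qed.

Lemma functional_sum (I : Type) (s : seq I) (c : I -> R) (u : I -> T -> R) :
  (forall i, u i \in Lfun mu r%:E) ->
  Lam (fun x => \sum_(i <- s) c i * u i x) = \sum_(i <- s) c i * Lam (u i).
Proof.
move=> uL; elim: s => [|i s IH].
  rewrite [RHS]big_nil -[RHS]functional0; congr Lam.
  by apply/funext => x; rewrite big_nil.
rewrite big_cons -IH -Lam_lin//; last first.
  apply: (@Lfun_sum _ _ _ mu r _ s (fun i x => c i * u i x)) => // j.
  exact: (Lfun_Z (c j) r1 (uL j)).1.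
by congr Lam; apply/funext => x; rewrite big_cons.
Qed.

End functional_continuity.

Lemma Rintegral_sum d (T : measurableType d) (R : realType)
    (mu : {measure set T -> \bar R}) (I : Type) (s : seq I) (c : I -> R)
    (g : I -> T -> R) : (forall i, mu.-integrable setT (EFin \o g i)) ->
  \int[mu]_x (\sum_(i <- s) c i * g i x) = \sum_(i <- s) c i * \int[mu]_x g i x.
Proof.
move=> ig; have igs t : mu.-integrable setT (EFin \o (fun x => \sum_(i <- t) c i * g i x)).
  rewrite (_ : EFin \o _ = fun x => (\sum_(i <- t) (c i)%:E * (g i x)%:E)%E).
    by apply: integrable_sum => // i _; exact: (integrableZl _ (c i) (ig i)).
  by apply/funext => x /=; rewrite -sumEFin.
elim: s => [|i s IH].
  under eq_Rintegral do rewrite big_nil.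
  by rewrite Rintegral_cst// mul0r big_nil.
under eq_Rintegral do rewrite big_cons.
rewrite RintegralD//; last exact: (integrableZl _ (c i) (ig i)).
by rewrite RintegralZl// IH big_cons.
Qed.

Section riesz.
Context {d : measure_display} {T : measurableType d} {R : realType}.
Variables (mu : {measure set T -> \bar R}) (r r' K : R) (Lam : (T -> R) -> R).
Variable D : set T.
Hypothesis r_gt1 : 1 < r.
Hypothesis conj_rr' : r^-1 + r'^-1 = 1.
Hypothesis mu_sf : sigma_finite setT mu.
Hypothesis K_ge0 : 0 <= K.
Hypothesis Lam_lin : forall (t : R) u v,
  u \in Lfun mu r%:E -> v \in Lfun mu r%:E ->
  Lam (fun x => t * u x + v x) = t * Lam u + Lam v.
Hypothesis Lam_bnd : forall u, u \in Lfun mu r%:E -> `|Lam u| <= K * Lrnorm mu r u.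
Hypothesis mD : measurable D.
Hypothesis Doo : (mu D < +oo)%E.

Let r0 : 0 < r := lt_trans ltr01 r_gt1.
Let r1 : 1 <= r := ltW r_gt1.

Let indicL A : measurable A -> (\1_(A `&` D) : T -> R) \in Lfun mu r%:E.
Proof.
move=> mA; apply: (Lfun_indic r0 _ _).1; first exact: measurableI.
apply: le_lt_trans Doo; apply: le_measure; rewrite ?inE//.
exact: measurableI.
Qed.

(** Disjointness leaves one nonzero term, so the partial sums at [x] jump once from 0 to 1 and stay
    there. This yields both the domination and the pointwise convergence needed for countable
    additivity. *)
Lemma sum_indic_trivIset (F : (set T)^nat) (i n : nat) (x : T) :
  trivIset setT F -> F i x -> \sum_(j < n) \1_(F j) x = (i < n)%:R :> R.
Proof.
move=> tF Fi; elim: n => [|n IH]; first by rewrite big_ord0.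
rewrite big_ord_recr/= IH indicE.
have [->|ni] := eqVneq n i; first by rewrite ltnn mem_set// ltnS leqnn add0r.
rewrite memNset ?addr0; last first.
  move=> Fn; move/eqP: ni; apply; apply: tF => //.
  by exists x.
by rewrite ltnS [in RHS]leq_eqVlt eq_sym (negbTE ni).
Qed.

Let nu (A : set T) : \bar R := (Lam \1_(A `&` D))%:E.

(** The partial sums of the indicators are dominated by the indicator of the union intersected with
    [D], which is in L^r because [D] has finite measure. *)
Let nu_sigma_additive : semi_sigma_additive nu.
Proof.
move=> F mF tF mUF.
pose u_ n x : R := \sum_(i < n) 1 * \1_(F i `&` D) x.
have tFD : trivIset setT (fun i => F i `&` D).
  by apply: trivIset_setIr.
have ucase x : (exists2 i, (F i `&` D) x & forall n, u_ n x = (i < n)%:R) \/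
    ((forall n, u_ n x = 0) /\ ~ ((\bigcup_n F n) `&` D) x).
  have [[[i _ Fi] Dx]|nx] := pselect (((\bigcup_n F n) `&` D) x).
    left; exists i => // n; rewrite -(sum_indic_trivIset n tFD (conj Fi Dx)).
    by apply: eq_bigr => j _; rewrite mul1r.
  right; split=> // n; rewrite /u_ big1// => j _; rewrite indicE memNset ?mulr0//.
  by move=> [Fj Dx]; apply: nx; split => //; exists j.
have inU x i : (F i `&` D) x -> ((\bigcup_n F n) `&` D) x.
  by move=> [Fi Dx]; split => //; exists i.
have u_L n : u_ n \in Lfun mu r%:E.
  apply: (@Lfun_sum _ _ _ mu r _ (index_enum 'I_n) (fun i x => 1 * \1_(F i `&` D) x)) => // i.
  by apply: (Lfun_Z _ r1 _).1; exact: indicL.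
have : Lam (u_ n) @[n --> \oo] --> Lam \1_((\bigcup_n F n) `&` D).
  apply: (functional_dominated_cvg r1 Lam_lin Lam_bnd).
  - by move=> n; exact: Lfun_meas (u_L n).
  - exact: indicL.
  - move=> n x; have [[i Fi ->]|[-> _]] := ucase x; last by rewrite normr0.
    rewrite indicE mem_set; last exact: inU Fi.
    by case: (i < n)%N; rewrite ?normr0 ?normr1.
  - move=> x; have [[i Fi ux]|[ux nx]] := ucase x.
      rewrite indicE mem_set; last exact: inU Fi.
      apply: cvg_near_cst; exists i.+1 => // n /= ni.
      by rewrite ux ni.
    by rewrite indicE memNset//; apply: cvg_near_cst; apply: nearW.
have e n : (\sum_(0 <= i < n) nu (F i))%E = (Lam (u_ n))%:E.
  rewrite /u_ (functional_sum r1 Lam_lin); last by move=> i; exact: indicL.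
  by rewrite big_mkord sumEFin; congr EFin; apply: eq_bigr => i _; rewrite mul1r.
by rewrite (funext e) => h; apply: cvg_EFin => //; exact: nearW.
Qed.

Lemma riesz_charge : exists f : T -> R,
  [/\ mu.-integrable setT (EFin \o f), (forall x, ~ D x -> f x = 0) &
   forall A, measurable A -> Lam \1_(A `&` D) = \int[mu]_(x in A) f x].
Proof.
have L0 := functional0 r1 Lam_lin.
have [||||f [intf fE]] := @radon_nikodym_fun _ _ _ mu nu mu_sf.
- rewrite /nu set0I; congr EFin; rewrite -[RHS]L0; congr Lam.
  by apply/funext => x; rewrite indic0.
- by [].
- exact: nu_sigma_additive.
- move=> A mA A0; rewrite /nu; congr EFin; apply/eqP; rewrite -normr_le0.
  apply: le_trans (Lam_bnd (indicL mA)) _.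
  have AD0 : mu (A `&` D) = 0%E.
    by apply: (subset_measure0 _ mA _ A0) => //; exact: measurableI.
  have ADoo : (mu (A `&` D) < +oo)%E by rewrite AD0.
  rewrite (Lfun_indic r0 (measurableI _ _ mA mD) ADoo).2 AD0/= powR0 ?mulr0//.
  by rewrite invr_neq0// gt_eqF.
(* [nu] sees only the part of a set inside [D]; cutting the density makes it vanish off [D] at every
   point and keeps the representation. *)
exists (f \_ D); split.
- rewrite -restrict_EFin; apply/(integrable_mkcond _ mD).
  exact: integrableS intf.
- by move=> x Dx; rewrite patchE memNset.
- move=> A mA; rewrite -Rintegral_mkcondr.
  by rewrite /Rintegral -fE ?/nu/= -?setIA ?setIid//; exact: measurableI.
Qed.

Import HBNNSimple.

(** The representation is first proved for those [u] whose product with [f] is integrable, as [f] is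
    only known to be in L^1. The converse of Hoelder's inequality tests only with such [u]; it puts
    [f] in L^r', after which every product is integrable and the restriction disappears. *)
Lemma riesz_finite_measure : exists f : T -> R,
  [/\ f \in Lfun mu r'%:E, (forall x, ~ D x -> f x = 0) &
   forall u, u \in Lfun mu r%:E -> Lam (u \_ D) = \int[mu]_x (f x * u x)].
Proof.
have [f [intf f0 fE]] := riesz_charge.
have mf : measurable_fun setT f.
  by apply/measurable_EFinP; exact: measurable_int intf.
have fD u : (fun x => f x * u x) \_ D = (fun x => f x * u x).
  apply/funext => x; rewrite patchE; case: ifPn => // /negP Dx.
  by rewrite f0 ?mul0r// => /mem_set.
exists f.
have simple (phi : {nnsfun T >-> R}) : Lam (phi \_ D) = \int[mu]_x (f x * phi x).
  pose s := finmap.enum_fset (fset_set (range phi)); pose A i := phi @^-1` [set s`_i].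
  have mA i : measurable (A i) by exact: measurable_sfunP.
  have -> : phi \_ D = fun x => \sum_(i < size s) s`_i * \1_(A i `&` D) x.
    apply/funext => x; rewrite patchE; case: ifPn => [Dx|Dx].
      rewrite fimfunEord; apply: eq_bigr => i _; congr (_ * _).
      by rewrite !indicE in_setI Dx andbT.
    rewrite big1// => i _; rewrite indicE in_setI (negbTE Dx) andbF mulr0//.
  rewrite (functional_sum r1 Lam_lin); last by move=> i; exact: indicL.
  transitivity (\int[mu]_x (\sum_(i < size s) s`_i * (f \_ (A i)) x)).
    rewrite Rintegral_sum; last first.
      move=> i; rewrite -restrict_EFin; apply/(integrable_mkcond _ (mA i)).
      exact: integrableS intf.
    by apply: eq_bigr => i _; rewrite fE// Rintegral_mkcond.
  apply: eq_Rintegral => x _; rewrite [in RHS]fimfunEord mulr_sumr.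
  apply: eq_bigr => i _; rewrite patchE indicE -/s -/(A i).
  by case: (x \in A i); rewrite ?mulr1 ?mulr0// mulrC.
have nonneg u : u \in Lfun mu r%:E -> (forall x, 0 <= u x) ->
    mu.-integrable setT (EFin \o (fun x => f x * u x)) ->
    Lam (u \_ D) = \int[mu]_x (f x * u x).
  move=> uL u0 ifu; have mu' := Lfun_meas uL.
  have [phi [phile _ phicvg]] := nnsfun_nd_cvg mu' u0.
  have c1 : Lam (phi n \_ D) @[n --> \oo] --> Lam (u \_ D).
    apply: (functional_dominated_cvg r1 Lam_lin Lam_bnd).
    - by move=> n; exact: measurable_restr.
    - exact: (Lfun_restr r0 mD uL).1.
    - move=> n x; rewrite !patchE; case: ifP => // _.
      by rewrite !ger0_norm.
    - move=> x; rewrite patchE; case: ifPn => Dx.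
        under eq_fun do rewrite patchE Dx.
        exact: phicvg.
      under eq_fun do rewrite patchE (negbTE Dx).
      exact: cvg_cst.
  have c2 : \int[mu]_x (f x * phi n x) @[n --> \oo] --> \int[mu]_x (f x * u x).
    apply: fine_cvg; rewrite /Rintegral fineK; last exact: integrable_fin_num ifu.
    have [] // := @dominated_convergence _ _ _ mu _ measurableT
      (fun n x => (f x * phi n x)%:E) (fun x => (f x * u x)%:E)
      (fun x => `|(f x * u x)%:E|%E).
    - move=> n; apply/measurable_EFinP; exact: measurable_funM.
    - exact: measurable_int ifu.
    - apply: aeW => x _; apply: cvg_EFin; first exact: nearW.
      by apply: cvgM; [exact: cvg_cst|exact: phicvg].
    - exact: integrable_abse ifu.
    - apply: aeW => x n _; rewrite lee_fin !normrM ler_wpM2l//.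
      by rewrite !ger0_norm.
  apply: (cvg_unique _ c1); first exact: norm_hausdorff.
  by rewrite (funext (fun n => simple (phi n))).
have signed u : u \in Lfun mu r%:E ->
    mu.-integrable setT (EFin \o (fun x => f x * u x)) ->
    Lam (u \_ D) = \int[mu]_x (f x * u x).
  move=> uL ifu; have mu' := Lfun_meas uL.
  pose p x := Num.max (u x) 0; pose q x := Num.max (- u x) 0.
  have part (v : T -> R) : measurable_fun setT v -> (forall x, `|v x| <= `|u x|) ->
      v \in Lfun mu r%:E /\ mu.-integrable setT (EFin \o (fun x => f x * v x)).
    move=> mv vu; split; first exact: (Lfun_le r0 mv vu uL).1.
    apply: le_integrable ifu => //.
      exact/measurable_EFinP/measurable_funM.
    by move=> x _ /=; rewrite lee_fin !normrM ler_wpM2l.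
  have p0 x : 0 <= p x by rewrite le_max lexx orbT.
  have q0 x : 0 <= q x by rewrite le_max lexx orbT.
  have [||pL ifp] := part p; first exact: measurable_maxr.
    move=> x; rewrite (ger0_norm (p0 x)) /p; case: (leP (u x) 0) => // _.
    exact: ler_norm.
  have [||qL ifq] := part q.
  - by apply: measurable_maxr => //; exact: measurableT_comp.
  - move=> x; rewrite (ger0_norm (q0 x)) /q; case: (leP (- u x) 0) => // _.
    by rewrite -normrN ler_norm.
  have upq x : u x = p x - q x.
    by rewrite /p /q; case: (leP (u x) 0); case: (leP (- u x) 0) => *; lra.
  have -> : u \_ D = fun x => -1 * (q \_ D) x + (p \_ D) x.
    apply/funext => x; rewrite !patchE; case: ifP => _.
      by rewrite upq mulN1r addrC.
    by rewrite mulr0 addr0.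
  rewrite Lam_lin ?(Lfun_restr r0 mD qL).1 ?(Lfun_restr r0 mD pL).1//.
  rewrite !nonneg// mulN1r addrC -RintegralB//.
  by apply: eq_Rintegral => x _; rewrite upq mulrBr.
have fL : f \in Lfun mu r'%:E.
  have r'0 : 0 < r' := lt_trans ltr01 (conjugate_gt1 r_gt1 conj_rr').
  apply: (Lfun_intP mu f r'0).2; split => //.
  have := @converse_hoelder _ _ _ mu r r' K D f r_gt1 conj_rr' mD Doo mf
     (integrableS measurableT mD (@subsetT _ _) intf) K_ge0.
  have -> : (\int[mu]_x (`|f x| `^ r')%:E = \int[mu]_(x in D) (`|f x| `^ r')%:E)%E.
    rewrite [RHS]integral_mkcond; apply: eq_integral => x _.
    rewrite patchE; case: ifPn => // /negP Dx.
    by rewrite f0 ?normr0 ?powR0 ?gt_eqF// => /mem_set.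
  move=> H; apply: le_lt_trans (H _) (ltry _) => u uL u0 ifu.
  have ifu' : mu.-integrable setT (EFin \o (fun x => f x * u x)).
    by rewrite -fD -restrict_EFin; apply/(integrable_mkcond _ mD).
  rewrite Rintegral_mkcond fD -signed//.
  apply: le_trans (Lam_bnd (Lfun_restr r0 mD uL).1) _.
  by rewrite ler_wpM2l// (Lfun_restr r0 mD uL).2.
split => // u uL; apply: signed => //.
have r'0 : 0 < r' := lt_trans ltr01 (conjugate_gt1 r_gt1 conj_rr').
by apply: (hoelder_int r'0 r0 _ fL uL).1; rewrite addrC.
Qed.

End riesz.

(** * Balls in a locally doubling space *)

Section balls.
Context {d : measure_display} {R : realType} {M : borelMetricType d R}.
Variable mu : {measure set M -> \bar R}.

Lemma in_ball (c y : M) (s : R) : ball c s y = (mdist c y < s) :> Prop.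
Proof. by rewrite ballEmdist. Qed.

Lemma borel_measurable_ball (c : M) (s : R) : measurable (ball c s).
Proof.
rewrite borel_measurableE; apply: sub_sigma_algebra.
rewrite openE => y; rewrite in_ball => cy.
apply/nbhs_ballP; exists (s - mdist c y) => /=; first by rewrite subr_gt0.
move=> z; rewrite !in_ball => yz.
by apply: le_lt_trans (metric_triangle c y z) _; rewrite addrC -ltrBrDr.
Qed.

Lemma bigcup_ball (c : M) : \bigcup_n ball c n%:R = [set: M].
Proof.
apply/seteqP; split => // y _; exists (Num.truncn (mdist c y)).+1 => //.
by rewrite in_ball; apply: truncnS_gt.
Qed.

Lemma sub_ball (c x : M) (s t : R) : mdist c x + s <= t -> ball x s `<=` ball c t.
Proof.
move=> h y; rewrite !in_ball => xy.
apply: le_lt_trans (metric_triangle c x y) _.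
by apply: lt_le_trans h; rewrite ltrD2l.
Qed.

Hypothesis mu_gt0 : (0 < mu [set: M])%E.
Hypothesis mu_ball_fin : forall (c : M) (s : R), 0 < s -> (mu (ball c s) < +oo)%E.
Hypothesis ldp : local_doubling mu.

Lemma iter_doubling (s : R) (n : nat) : 0 < s -> exists C : R,
  0 <= C /\ forall c : M, (mu (ball c (2 ^+ n * s)) <= C%:E * mu (ball c s))%E.
Proof.
move=> s0; elim: n => [|n [C [C0 IH]]].
  by exists 1; split => // c; rewrite expr0 mul1r mul1e.
have sn0 : 0 < 2 ^+ n * s by rewrite mulr_gt0// exprn_gt0.
(* The doubling constant is not given as nonnegative, and the product estimate needs it to be. *)
have [D HD] := ldp sn0; exists (Num.max D 0 * C); split.
  by rewrite mulr_ge0// le_max lexx orbT.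
move=> c; have := HD c (2 ^+ n * s); rewrite sn0 lexx => /(_ isT).
rewrite exprS -mulrA => /le_trans; apply.
apply: (@le_trans _ _ ((Num.max D 0)%:E * mu (ball c (2 ^+ n * s)))%E).
  by rewrite lee_wpmul2r// lee_fin le_max lexx.
by rewrite EFinM -muleA lee_wpmul2l// lee_fin le_max lexx orbT.
Qed.

Lemma exists_expn2_ge (t : R) : exists n, t <= 2 ^+ n.
Proof.
exists (Num.truncn t).+1; apply: ltW; apply: lt_trans (truncnS_gt t) _.
by rewrite -natrX ltr_nat ltn_expl.
Qed.

(** If one ball were null, iterated doubling would make all concentric balls null, and these exhaust
    the space. *)
Lemma mu_ball_gt0 (c : M) (s : R) : 0 < s -> (0 < mu (ball c s))%E.
Proof.
move=> s0; rewrite lt0e measure_ge0 andbT; apply/eqP => mu0.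
have mun n : mu (ball c n%:R) = 0%E.
  have [k hk] := exists_expn2_ge (n%:R / s).
  have [C [_ HC]] := iter_doubling k s0.
  apply/eqP; rewrite -measure_le0; apply: (@le_trans _ _ (mu (ball c (2 ^+ k * s)))).
    apply: le_measure; rewrite ?inE; try exact: borel_measurable_ball.
    by apply: le_ball; rewrite -ler_pdivrMr.
  by apply: le_trans (HC c) _; rewrite mu0 mule0.
move: mu_gt0; apply/negP; rewrite -leNgt measure_le0.
have : mu.-negligible (\bigcup_n ball c n%:R).
  apply: negligible_bigcup => n; exists (ball c n%:R); split => //.
  exact: borel_measurable_ball.
by rewrite bigcup_ball => /(negligibleP mu measurableT) ->.
Qed.

(* A maximal e-separated set is finite: the e/2-balls around its points are
   disjoint and by doubling their measures are bounded below. *)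
Lemma ball_cover (c : M) (s e : R) : 0 < s -> 0 < e ->
  exists xs : seq M, forall y, ball c s y -> exists2 x, x \in xs & ball x e y.
Proof.
move=> s0 e0; apply: contrapT => ncov.
have e20 : 0 < e / 2 by rewrite divr_gt0.
(* After [k] doublings, an e/2-ball centred in [ball c s] has radius at least [2 * s] and so
   contains [ball c s]. *)
have [k hk] := exists_expn2_ge (2 * s / (e / 2)).
have [C [C0 HC]] := iter_doubling k e20.
set m := fine (mu (ball c s)).
have mE : m%:E = mu (ball c s) by rewrite fineK// ge0_fin_numE// mu_ball_fin.
have m0 : 0 < m by rewrite -lte_fin mE; exact: mu_ball_gt0.
have lb y : ball c s y -> (m%:E <= C%:E * mu (ball y (e / 2)))%E.
  move=> cy; rewrite mE; apply: le_trans (HC y).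
  apply: le_measure; rewrite ?inE; try exact: borel_measurable_ball.
  apply: sub_ball; move: hk; rewrite ler_pdivrMr//; apply: le_trans.
  by move: cy; rewrite in_ball metric_sym => /ltW ys; lra.
pose U (xs : seq M) := \big[setU/set0]_(x <- xs) ball x (e / 2).
have mU xs : measurable (U xs).
  by apply: bigsetU_measurable => i _; exact: borel_measurable_ball.
have UP xs y : U xs y -> exists2 x, x \in xs & ball x (e / 2) y.
  by rewrite /U -bigcup_seq => -[x /= xxs xy]; exists x.
(* As no finite cover exists, any list can be extended by a point outside its e-balls, and the new
   e/2-ball is disjoint from the old ones. *)
have main n : exists xs : seq M, (forall x, x \in xs -> ball c s x) /\
    ((n%:R * m)%:E <= C%:E * mu (U xs))%E.
  elim: n => [|n [xs [xsc xsm]]].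
    by exists [::]; split => //; rewrite /U big_nil measure0 mule0 mul0r.
  have [y [cy ny]] : exists y, ball c s y /\ forall x, x \in xs -> ~ ball x e y.
    apply: contrapT => H; apply: ncov; exists xs => y cy.
    apply: contrapT => ny; apply: H; exists y; split => // x xxs xy.
    by apply: ny; exists x.
  exists (y :: xs); split.
    by move=> x; rewrite inE => /orP[/eqP->//|]; exact: xsc.
  rewrite /U big_cons measureU; [|exact: borel_measurable_ball|exact: mU|]; last first.
    apply/seteqP; split => // z [yz /UP[x xxs xz]]; apply: (ny x xxs).
    move: yz xz; rewrite !in_ball => yz xz.
    apply: le_lt_trans (metric_triangle x z y) _.
    by rewrite (metric_sym z y) [e]splitr ltrD.
  rewrite muleDr// ?ge0_adde_def ?inE// mulrSr mulrDl mul1r addrC EFinD.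
  by apply: leeD => //; exact: lb.
have se0 : 0 < s + e by rewrite addr_gt0.
have Boo := mu_ball_fin c se0.
pose B := fine (mu (ball c (s + e))).
have BE : B%:E = mu (ball c (s + e)) by rewrite fineK// ge0_fin_numE.
(* The e/2-balls all lie in [ball c (s + e)], which leaves room for at most [C * B / m] of them;
   take one more. *)
have [xs [xsc xsm]] := main (Num.truncn (C * B / m)).+1.
have : ((Num.truncn (C * B / m)).+1%:R * m <= C * B).
  rewrite -lee_fin; apply: le_trans xsm _.
  rewrite EFinM BE lee_wpmul2l ?lee_fin//.
  apply: le_measure; rewrite ?inE//; first exact: borel_measurable_ball.
  move=> z /UP[x xxs xz]; apply: sub_ball xz.
  by have := xsc x xxs; rewrite in_ball => /ltW; lra.
rewrite -ler_pdivlMr// leNgt => /negP; apply; exact: truncnS_gt.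
Qed.

Lemma sigma_finite_balls : sigma_finite setT mu.
Proof.
exists (fun n => ball (point : M) n%:R); first by rewrite bigcup_ball.
move=> n; split; first exact: borel_measurable_ball.
(* The finiteness hypothesis needs a positive radius, and [n] may be 0. *)
apply: (@le_lt_trans _ _ (mu (ball (point : M) n.+1%:R))).
  apply: le_measure; rewrite ?inE; try exact: borel_measurable_ball.
  by apply: le_ball; rewrite ler_nat.
exact: mu_ball_fin.
Qed.

End balls.

(** * Atoms and their finite combinations *)

Section centering.
Context {d : measure_display} {T : measurableType d} {R : realType}.
Variables (mu : {measure set T -> \bar R}) (r r' : R).
Hypothesis r_gt1 : 1 < r.
Hypothesis conj_rr' : r^-1 + r'^-1 = 1.

Let r0 : 0 < r := lt_trans ltr01 r_gt1.
Let r1 : 1 <= r := ltW r_gt1.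
Let r'0 : 0 < r' := lt_trans ltr01 (conjugate_gt1 r_gt1 conj_rr').

Definition nindic (B : set T) (x : T) : R := (fine (mu B))^-1 * \1_B x.

Definition centered (B : set T) (w : T -> R) (x : T) : R :=
  w x - (\int[mu]_y w y) * nindic B x.

Variable B : set T.
Hypothesis mB : measurable B.
Hypothesis B_gt0 : (0 < mu B)%E.
Hypothesis B_fin : (mu B < +oo)%E.

Let m := fine (mu B).
Let m0 : 0 < m. Proof. by rewrite fine_gt0// B_gt0. Qed.

Lemma supp_restr (w : T -> R) : (forall x, ~ B x -> w x = 0) -> w \_ B = w.
Proof.
move=> w0; apply/funext => x; rewrite patchE; case: ifPn => // /negP Bx.
by rewrite w0// => /mem_set.
Qed.

Lemma supp_Lfun_integrable (w : T -> R) : w \in Lfun mu r%:E ->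
  (forall x, ~ B x -> w x = 0) ->
  mu.-integrable setT (EFin \o w) /\
  `|\int[mu]_x w x| <= Lrnorm mu r w * m `^ r'^-1.
Proof.
move=> wL w0; have [iw le] := hoelder_set r0 r'0 conj_rr' mB B_fin wL.
move: iw le => /(integrable_mkcond _ mB).
by rewrite Rintegral_mkcond restrict_EFin supp_restr.
Qed.

Lemma nindic_Lfun : nindic B \in Lfun mu r%:E /\ Lrnorm mu r (nindic B) <= m^-1 * m `^ r^-1.
Proof.
have [iL iN] := Lfun_indic r0 mB B_fin.
have [bL bN] := Lfun_Z (fine (mu B))^-1 r1 iL.
by split => //; apply: le_trans bN _; rewrite iN ger0_norm// invr_ge0 ltW.
Qed.

Lemma nindic_out x : ~ B x -> nindic B x = 0.
Proof. by move=> Bx; rewrite /nindic indicE memNset ?mulr0. Qed.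

Lemma int_nindic : mu.-integrable setT (EFin \o nindic B) /\ \int[mu]_x nindic B x = 1.
Proof.
have [bL _] := nindic_Lfun.
split; first exact: (supp_Lfun_integrable bL nindic_out).1.
have [iL _] := Lfun_indic r0 mB B_fin.
have i1 : mu.-integrable setT (EFin \o (\1_B : T -> R)).
  by apply: (supp_Lfun_integrable iL _).1 => x Bx; rewrite indicE memNset.
rewrite RintegralZl// /Rintegral integral_indic// setIT mulVf//.
by rewrite gt_eqF.
Qed.

(** By Hoelder the integral of [w] is at most [m^(1/r')] times its norm, and the normalised
    indicator has norm at most [m^(1/r - 1)]. The powers of [m] cancel, so the correction costs at
    most one more norm of [w]. *)
Lemma centered_Lfun (w : T -> R) : w \in Lfun mu r%:E -> (forall x, ~ B x -> w x = 0) ->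
  [/\ centered B w \in Lfun mu r%:E, (forall x, ~ B x -> centered B w x = 0),
      \int[mu]_x centered B w x = 0 & Lrnorm mu r (centered B w) <= 2 * Lrnorm mu r w].
Proof.
move=> wL w0; have [bL bN] := nindic_Lfun.
have [iw wle] := supp_Lfun_integrable wL w0.
have [ib b1] := int_nindic.
have cE : centered B w = fun x => (- \int[mu]_y w y) * nindic B x + w x.
  by apply/funext => x; rewrite /centered mulNr addrC.
have [cL cN] := Lfun_lin (- \int[mu]_y w y) r1 bL wL.
split; rewrite ?cE//.
- by move=> x Bx; rewrite nindic_out// w0// mulr0 addr0.
- rewrite RintegralD//; last exact: (integrableZl _ _ ib).
  by rewrite RintegralZl// b1 mulr1 addNr.
- apply: le_trans cN _; rewrite normrN mulr_natl mulr2n lerD2r.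
  apply: le_trans (ler_pM _ _ wle bN) _ => //; first exact: Lrnorm_ge0.
  rewrite -mulrA -[leRHS]mulr1 ler_wpM2l ?Lrnorm_ge0//.
  rewrite mulrCA -powRD; last by rewrite addrC conj_rr' oner_eq0.
  by rewrite addrC conj_rr' powRr1 ?mulVf// ?gt_eqF// ltW.
Qed.

End centering.

Section atoms.
Context {d : measure_display} {R : realType} {M : borelMetricType d R}.
Variables (mu : {measure set M -> \bar R}) (r r' : R).
Hypothesis r_gt1 : 1 < r.
Hypothesis conj_rr' : r^-1 + r'^-1 = 1.
Hypothesis ball_gt0 : forall (c : M) (s : R), 0 < s -> (0 < mu (ball c s))%E.
Hypothesis ball_fin : forall (c : M) (s : R), 0 < s -> (mu (ball c s) < +oo)%E.

Let r0 : 0 < r := lt_trans ltr01 r_gt1.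
Let r1 : 1 <= r := ltW r_gt1.
Let r'0 : 0 < r' := lt_trans ltr01 (conjugate_gt1 r_gt1 conj_rr').

Let m c s := fine (mu (ball c s)).
Let m0 c s : 0 < s -> 0 < m c s.
Proof. by move=> s0; rewrite fine_gt0// ball_gt0//= ball_fin. Qed.

Lemma Lq_meanE (c : M) (s : R) (a : M -> R) : 0 < s -> a \in Lfun mu r%:E ->
  (forall x, ~ ball c s x -> a x = 0) ->
  Lq_mean mu r (ball c s) a = ((m c s) `^ (- r^-1) * Lrnorm mu r a)%:E.
Proof.
move=> s0 aL a0; rewrite /Lq_mean -/(m c s).
have -> : (\int[mu]_(x in ball c s) (`|a x| `^ r)%:E =
           \int[mu]_x (`|a x| `^ r)%:E)%E.
  rewrite integral_mkcond; apply: eq_integral => x _.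
  rewrite patchE; case: ifPn => // /negP Bx.
  by rewrite a0 ?normr0 ?powR0 ?gt_eqF// => /mem_set.
rewrite -Lrnorm_powR// -EFinM poweR_EFin; congr EFin.
have mp := m0 c s0; have mge0 := ltW mp.
rewrite powRM ?invr_ge0 ?powR_ge0// -powRrM mulfV ?gt_eqF//.
rewrite powRr1 ?Lrnorm_ge0//; congr (_ * _).
by rewrite -(powR_inv1 mge0) -powRrM mulN1r.
Qed.

(** Turns the size condition on an atom into the form norm times [m^(1/r')] at most 1, which is what
    pairs with Hoelder's inequality. *)
Lemma ball_mean_weight (c : M) (s : R) : 0 < s ->
  (m c s) `^ r'^-1 * (m c s)^-1 = (m c s) `^ (- r^-1).
Proof.
move=> s0; have mp := m0 c s0; rewrite -(powR_inv1 (ltW mp)) -powRD; last first.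
  by apply/implyP => _; rewrite gt_eqF.
by congr (_ `^ _); rewrite -conj_rr'; lra.
Qed.

(** [t] is any positive upper bound rather than the exact size, which vanishes when [v] is zero. *)
Lemma atom_le_scaled (b t s : R) (c : M) (v : M -> R) : 0 < s <= b -> 0 < t ->
  v \in Lfun mu r%:E -> (forall x, ~ ball c s x -> v x = 0) ->
  \int[mu]_x v x = 0 -> Lrnorm mu r v * (m c s) `^ r'^-1 <= t ->
  atom_le mu b r (fun x => t^-1 * v x).
Proof.
move=> sb t0 vL v0 iv0 vt; have s0 : 0 < s by case/andP: sb.
have mB := borel_measurable_ball c s.
have [iv _] := supp_Lfun_integrable r_gt1 conj_rr' mB (ball_fin c s0) vL v0.
have [tL tN] := Lfun_Z t^-1 r1 vL.
have t0' x : ~ ball c s x -> t^-1 * v x = 0 by move=> Bx; rewrite v0// mulr0.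
exists c, s; split => //; split.
- exact: (integrableZl _ _ iv).
- exact: aeW.
- rewrite Rintegral_mkcond supp_restr// RintegralZl// iv0 mulr0//.
- have mp := m0 c s0; have mr' := powR_gt0 r'^-1 mp.
  rewrite Lq_meanE// lee_fin -ball_mean_weight// mulrAC.
  rewrite -[leRHS]mul1r ler_pM2r ?invr_gt0// mulrC.
  apply: le_trans (ler_wpM2r (ltW mr') tN) _.
  rewrite ger0_norm ?invr_ge0 ?(ltW t0)// -mulrA.
  by rewrite -(mulVf (lt0r_neq0 t0)) ler_pM2l ?invr_gt0.
Qed.

(* An atom vanishes off its ball only almost everywhere; cutting it off makes
   its L^r norm, which the definition controls on the ball only, available. *)
Lemma atom_restr (c : M) (s : R) (a : M -> R) : 0 < s -> atom_on mu r (ball c s) a ->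
  let a' := a \_ (ball c s) in
  [/\ a' \in Lfun mu r%:E, (forall x, ~ ball c s x -> a' x = 0),
      \int[mu]_x a' x = 0, {ae mu, forall x, a x = a' x} &
      Lrnorm mu r a' * (m c s) `^ r'^-1 <= 1].
Proof.
move=> s0 [ia aae a0 aN] a'.
have mB := borel_measurable_ball c s.
have ma : measurable_fun setT a by apply/measurable_EFinP; exact: measurable_int ia.
have a'0 x : ~ ball c s x -> a' x = 0 by move=> Bx; rewrite /a' patchE memNset.
have a'e x : x \in (ball c s : set M) -> a' x = a x.
  by move=> Bx; rewrite /a' patchE Bx.
have LqE : Lq_mean mu r (ball c s) a' = Lq_mean mu r (ball c s) a.
  by rewrite /Lq_mean; under eq_integral => x Bx do rewrite a'e//.
have a'L : a' \in Lfun mu r%:E.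
  apply: (Lfun_intP mu a' r0).2; split; first exact: measurable_restr.
  have -> : (\int[mu]_x (`|a' x| `^ r)%:E = \int[mu]_(x in ball c s) (`|a x| `^ r)%:E)%E.
    rewrite [RHS]integral_mkcond; apply: eq_integral => x _.
    rewrite /a' !patchE; case: ifPn => // _.
    by rewrite normr0 powR0// gt_eqF.
  move: aN; rewrite /Lq_mean => aN.
  have := le_lt_trans aN (ltry _) => /lty_poweRy; rewrite invr_neq0 ?gt_eqF//.
  move=> /(_ isT); apply: contraPT; rewrite -leNgt leye_eq => /eqP ->.
  by rewrite gt0_muley// lte_fin invr_gt0 m0.
split => //.
- by rewrite -Rintegral_mkcond.
- apply: filterS aae => x h; rewrite /a' patchE; case: ifPn => // /negP Bx.
  by apply: h => /mem_set.
- move: aN; rewrite -LqE Lq_meanE// lee_fin -ball_mean_weight//.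
  rewrite mulrAC -[leRHS]mul1r ler_pM2r ?invr_gt0 ?m0//.
  by rewrite mulrC.
Qed.

End atoms.

(** * Finite combinations of atoms on small balls, and linear functionals on the Hardy space *)

Section atomic_combinations.
Context {d : measure_display} {R : realType} {M : borelMetricType d R}.
Variables (mu : {measure set M -> \bar R}) (b r r' : R).
Hypothesis r_gt1 : 1 < r.
Hypothesis conj_rr' : r^-1 + r'^-1 = 1.
Hypothesis ball_gt0 : forall (c : M) (s : R), 0 < s -> (0 < mu (ball c s))%E.
Hypothesis ball_fin : forall (c : M) (s : R), 0 < s -> (mu (ball c s) < +oo)%E.
Hypothesis b_gt0 : 0 < b.

Let r0 : 0 < r := lt_trans ltr01 r_gt1.

(** Inductive, so that closure under linear combinations is a plain induction; [atomic_comb_seq]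
    converts to the sequences that [hardy] expects. *)
Inductive atomic_comb : (M -> R) -> Prop :=
| atomic_comb0 : atomic_comb (fun=> 0)
| atomic_comb_cons (t : R) (a g : M -> R) : atom_le mu b r a -> atomic_comb g ->
    atomic_comb (fun x => t * a x + g x).

Lemma atomic_comb_lin (t : R) (g h : M -> R) : atomic_comb g -> atomic_comb h ->
  atomic_comb (fun x => t * g x + h x).
Proof.
move=> gc hc; elim: gc => [|u a {}g aa _ IH].
  rewrite (_ : (fun x => _) = h)//.
  by apply/funext => x; rewrite mulr0 add0r.
rewrite (_ : (fun x => _) = (fun x => (t * u) * a x + (t * g x + h x))).
  exact: atomic_comb_cons.
by apply/funext => x; rewrite mulrDr addrA mulrA.
Qed.

Lemma atomic_comb_atom (t : R) (a : M -> R) : atom_le mu b r a ->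
  atomic_comb (fun x => t * a x).
Proof.
move=> aa; rewrite (_ : (fun x => _) = (fun x => t * a x + (fun=> 0) x)).
  exact: (atomic_comb_cons t aa atomic_comb0).
by apply/funext => x; rewrite addr0.
Qed.

(** Decompositions are indexed by all of [nat]; the zero atom pads the finite ones. *)
Lemma atom_le0 : atom_le mu b r (fun=> 0).
Proof.
have [z zN] := Lfun0 mu r0.
have := @atom_le_scaled _ _ _ mu r r' r_gt1 conj_rr' ball_gt0 ball_fin b 1 b (point : M)
  (fun=> 0) _ ltr01 z _ _ _.
under [X in _ -> _ -> _ -> _ -> atom_le _ _ _ X]eq_fun do rewrite mulr0.
apply => //; first by rewrite b_gt0 lexx.
- by rewrite Rintegral_cst// mul0r.
- by rewrite zN mul0r.
Qed.

Lemma atom_integrable (a : M -> R) : atom_le mu b r a -> mu.-integrable setT (EFin \o a).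
Proof. by move=> [c [s [_ []]]]. Qed.

Lemma integrable_comb (n : nat) (lam : nat -> R) (a : nat -> M -> R) :
  (forall k, atom_le mu b r (a k)) ->
  mu.-integrable setT (EFin \o (fun x => \sum_(k < n) lam k * a k x)).
Proof.
move=> ha; rewrite (_ : EFin \o _ = fun x => (\sum_(k < n) (lam k)%:E * (a k x)%:E)%E).
  apply: integrable_sum => // k _.
  exact: (integrableZl _ (lam k) (atom_integrable (ha k))).
by apply/funext => x /=; rewrite -sumEFin.
Qed.

Lemma finite_atomic_decomposition (n : nat) (lam : nat -> R) (a : nat -> M -> R) :
  (forall k, atom_le mu b r (a k)) -> (forall k, (n <= k)%N -> lam k = 0) ->
  atomic_decomposition mu b r (fun x => \sum_(k < n) lam k * a k x) lam a /\
  (\sum_(0 <= k <oo) (`|lam k|)%:E = (\sum_(k < n) `|lam k|)%:E)%E.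
Proof.
move=> ha lam0.
have S : (\sum_(0 <= k <oo) (`|lam k|)%:E = (\sum_(k < n) `|lam k|)%:E)%E.
  rewrite (nneseries_split _ n); last by move=> k _; rewrite lee_fin.
  rewrite [X in (_ + X)%E]eseries0 ?adde0.
    by rewrite add0n big_mkord sumEFin.
  by move=> k; rewrite add0n => nk _; rewrite lam0// normr0.
split => //; split => //; first by rewrite S ltry.
apply: cvg_near_cst; exists n => // N /= nN.
rewrite (eq_integral (cst 0%E)); first by rewrite integral0.
move=> x _ /=.
rewrite -!(big_mkord xpredT (fun k => lam k * a k x)).
rewrite (@big_cat_nat _ _ _ n 0 N)//= [X in _ - (_ + X)]big_nat.
rewrite [X in _ - (_ + X)]big1 ?addr0 ?subrr ?normr0//.
by move=> k /andP[nk _]; rewrite lam0// mul0r.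
Qed.

Lemma atomic_comb_seq (g : M -> R) : atomic_comb g ->
  exists (n : nat) (lam : nat -> R) (a : nat -> M -> R),
  [/\ forall k, atom_le mu b r (a k), forall k, (n <= k)%N -> lam k = 0 &
      g = fun x => \sum_(k < n) lam k * a k x].
Proof.
elim=> [|t a {}g aa _ [n [lam [a_ [ha lam0 ->]]]]].
  exists 0%N, (fun=> 0), (fun _ _ => 0); split => //; first by move=> _; exact: atom_le0.
  by apply/funext => x; rewrite big_ord0.
exists n.+1, (fun k => if k is k'.+1 then lam k' else t),
  (fun k => if k is k'.+1 then a_ k' else a); split.
- by case.
- by case.
- by apply/funext => x; rewrite big_ord_recl.
Qed.

Lemma atomic_comb_hardy (g : M -> R) : atomic_comb g -> hardy mu b r g.
Proof.
move=> /atomic_comb_seq[n [lam [a [ha lam0 ->]]]]; split; first exact: integrable_comb.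
by exists lam, a; exact: (finite_atomic_decomposition ha lam0).1.
Qed.

Lemma hardy_norm_atom (a : M -> R) : atom_le mu b r a ->
  hardy mu b r a /\ (hardy_norm mu b r a <= 1)%E.
Proof.
move=> aa; pose lam k : R := if k is 0%N then 1 else 0.
have lam0 k : (1 <= k)%N -> lam k = 0 by case: k.
have [D S] := @finite_atomic_decomposition 1 lam (fun=> a) (fun=> aa) lam0.
rewrite big_ord1 normr1 in S.
have e : (fun x => \sum_(k < 1) lam k * a x) = a.
  by apply/funext => x; rewrite big_ord1 mul1r.
rewrite e in D; split.
  by split; [exact: atom_integrable|exists lam, (fun=> a)].
rewrite -S; apply: ereal_inf_lbound.
by exists lam, (fun=> a).
Qed.

Lemma hardy_ae (g h : M -> R) : hardy mu b r g -> mu.-integrable setT (EFin \o h) ->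
  {ae mu, forall x, h x = g x} -> hardy mu b r h.
Proof.
move=> [ig [lam [a [ha S D]]]] ih hg; split => //; exists lam, a; split => //.
rewrite (_ : (fun n => _) = (fun n => \int[mu]_x
   (`|g x - \sum_(k < n) lam k * a k x|)%:E)%E)//.
apply/funext => n; apply: ae_eq_integral => //.
- apply/measurable_EFinP; apply: measurableT_comp => //; apply: measurable_funB.
    by apply/measurable_EFinP; exact: measurable_int ih.
  by apply/measurable_EFinP; exact: measurable_int (integrable_comb n lam ha).
- apply/measurable_EFinP; apply: measurableT_comp => //; apply: measurable_funB.
    by apply/measurable_EFinP; exact: measurable_int ig.
  by apply/measurable_EFinP; exact: measurable_int (integrable_comb n lam ha).
- by apply: filterS hg => x -> _.
Qed.

(** The norm is an infimum that need not be attained, so a decomposition of total weight below 2 is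
    scaled. This crude bound is enough for the finiteness of the dual norm. *)
Lemma hardy_scale (t : R) (g : M -> R) : hardy mu b r g -> (hardy_norm mu b r g <= 1)%E ->
  hardy mu b r (fun x => t * g x) /\
  (hardy_norm mu b r (fun x => (t * g x)%R) <= (`|t| * 2)%:E)%E.
Proof.
move=> [ig _] N1.
have lt12 : (1%:E < 2%:E :> \bar R)%E by rewrite lte_fin ltr1n.
have [_ [lam [a [[ha S D] ->]]] lt2] := ereal_inf_lt (le_lt_trans N1 lt12).
have tS : (\sum_(0 <= k <oo) (`|t * lam k|)%:E = `|t|%:E * \sum_(0 <= k <oo) (`|lam k|)%:E)%E.
  rewrite -nneseriesZl; last by move=> k _; rewrite lee_fin.
  by apply: eq_eseriesr => k _; rewrite normrM EFinM.
have dec : atomic_decomposition mu b r (fun x => t * g x) (fun k => t * lam k) a.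
  split => //; first by rewrite tS lte_mul_pinfty ?lee_fin.
  rewrite -(mule0 `|t|%:E) (_ : (fun n => _) = (fun n => `|t|%:E * \int[mu]_x
     (`|g x - \sum_(k < n) lam k * a k x|)%:E)%E); first exact: cvgeZl.
  apply/funext => n; rewrite -ge0_integralZl//; last first.
    apply/measurable_EFinP; apply: measurableT_comp => //; apply: measurable_funB.
      by apply/measurable_EFinP; exact: measurable_int ig.
    by apply/measurable_EFinP; exact: measurable_int (integrable_comb n lam ha).
  apply: eq_integral => x _; rewrite -EFinM -normrM mulrBr mulr_sumr.
  by under [in RHS]eq_bigr do rewrite mulrA.
split; first by split; [exact: (integrableZl _ t ig)|exists (fun k => t * lam k), a].
apply: le_trans (ereal_inf_lbound _) _; first by exists (fun k => t * lam k), a.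
by rewrite tS EFinM lee_wpmul2l ?lee_fin// ltW.
Qed.

Section functional.
Variable l : (M -> R) -> R.
Hypothesis l_lin : hardy_linear mu b r l.

Lemma hardy_linear_comb (t : R) (g h : M -> R) : atomic_comb g -> atomic_comb h ->
  l (fun x => t * g x + h x) = t * l g + l h.
Proof.
by move=> gc hc; apply: l_lin.2; exact: atomic_comb_hardy.
Qed.

Lemma hardy_linear0 : l (fun=> 0) = 0.
Proof.
have : l (fun=> 0) = 1 * l (fun=> 0) + l (fun=> 0).
  rewrite -(hardy_linear_comb 1 atomic_comb0 atomic_comb0); congr l.
  by apply/funext => x; rewrite mulr0 addr0.
rewrite mul1r.
by move/eqP; rewrite eq_sym -subr_eq0 addrK => /eqP.
Qed.

Lemma hardy_linearZ (t : R) (g : M -> R) : hardy mu b r g ->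
  l (fun x => t * g x) = t * l g.
Proof.
move=> gh; rewrite -[RHS]addr0 -hardy_linear0 -l_lin.2//; last first.
  exact: atomic_comb_hardy atomic_comb0.
by congr l; apply/funext => x; rewrite addr0.
Qed.

Lemma dual_norm_fin : hardy_continuous mu b r l ->
  exists2 K : R, 0 <= K & dual_norm mu b r l = K%:E.
Proof.
move=> lc; have h0 := atomic_comb_hardy atomic_comb0.
have [dl dl0 H] := lc _ h0 1 ltr01.
(* With [t = dl / 4] the scaled function has norm at most [dl / 2], strictly inside the
   neighbourhood where [l] is below 1. *)
have bnd g : hardy mu b r g -> (hardy_norm mu b r g <= 1)%E -> `|l g| <= 4 / dl.
  move=> gh g1; pose t := dl / 4.
  have t0 : 0 < t by rewrite divr_gt0.
  have [tgh tgN] := hardy_scale t gh g1.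
  have := H _ tgh; rewrite hardy_linear0 subr0 hardy_linearZ//.
  rewrite normrM gtr0_norm// mulrC -ltr_pdivlMr// div1r invf_div => h.
  apply/ltW/h; under [X in hardy_norm _ _ _ X]eq_fun do rewrite subr0.
  apply: le_lt_trans tgN _; rewrite lte_fin gtr0_norm// /t; lra.
have ge0 : (0 <= dual_norm mu b r l)%E.
  apply: ereal_sup_ubound; exists (fun=> 0); last by rewrite hardy_linear0 normr0.
  split => //; apply: (le_trans (ereal_inf_lbound _)); last exact: lee01.
  have [D S] := @finite_atomic_decomposition 0 (fun=> 0) (fun _ _ => 0) (fun=> atom_le0) (fun _ _ => erefl).
  exists (fun=> 0), (fun _ _ => 0); split.
    by move: D; under [X in atomic_decomposition _ _ _ X]eq_fun do rewrite big_ord0.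
  by rewrite S big_ord0.
have le : (dual_norm mu b r l <= (4 / dl)%:E)%E.
  by apply: ub_ereal_sup => _ [g [gh g1] <-]; rewrite lee_fin; exact: bnd.
have fin : dual_norm mu b r l \is a fin_num.
  by rewrite ge0_fin_numE// (le_lt_trans le) ?ltry.
by exists (fine (dual_norm mu b r l)); rewrite ?fine_ge0// fineK.
Qed.

Lemma dual_norm_atom (K : R) (a : M -> R) : dual_norm mu b r l = K%:E ->
  atom_le mu b r a -> `|l a| <= K.
Proof.
move=> lK aa; rewrite -lee_fin -lK; apply: ereal_sup_ubound.
by exists a => //; exact: hardy_norm_atom.
Qed.

End functional.

End atomic_combinations.

(** * Decomposing mean-zero functions of bounded support *)

Section decomposition.
Context {d : measure_display} {R : realType} {M : borelMetricType d R}.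
Variables (mu : {measure set M -> \bar R}) (b r r' : R).
Hypothesis r_gt1 : 1 < r.
Hypothesis conj_rr' : r^-1 + r'^-1 = 1.
Hypothesis ball_gt0 : forall (c : M) (s : R), 0 < s -> (0 < mu (ball c s))%E.
Hypothesis ball_fin : forall (c : M) (s : R), 0 < s -> (mu (ball c s) < +oo)%E.

Let r0 : 0 < r := lt_trans ltr01 r_gt1.
Let r1 : 1 <= r := ltW r_gt1.
Let r'0 : 0 < r' := lt_trans ltr01 (conjugate_gt1 r_gt1 conj_rr').

Lemma mean_zero_scaled_atom (c : M) (s t : R) (v : M -> R) : 0 < s <= b ->
  v \in Lfun mu r%:E -> (forall x, ~ ball c s x -> v x = 0) -> \int[mu]_x v x = 0 ->
  0 < t -> Lrnorm mu r v * (fine (mu (ball c s))) `^ r'^-1 <= t ->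
  atom_le mu b r (fun x => t^-1 * v x) /\ v = fun x => t * (t^-1 * v x).
Proof.
move=> sb vL v0 iv t0 vt; split.
  exact: (atom_le_scaled r_gt1 conj_rr' ball_gt0 ball_fin sb t0 vL v0 iv vt).
by apply/funext => x; rewrite mulVKf// gt_eqF.
Qed.

Lemma mean_zero_comb (c : M) (s : R) (v : M -> R) : 0 < s <= b ->
  v \in Lfun mu r%:E -> (forall x, ~ ball c s x -> v x = 0) -> \int[mu]_x v x = 0 ->
  atomic_comb mu b r v.
Proof.
move=> sb vL v0 iv; set t := Lrnorm mu r v * (fine (mu (ball c s))) `^ r'^-1.
have t0 : 0 <= t by rewrite mulr_ge0 ?Lrnorm_ge0 ?powR_ge0.
(* [t] may be 0, whereas the scaling factor must be positive. *)
have [|//|va ->] := mean_zero_scaled_atom sb vL v0 iv (t := t + 1).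
- by rewrite ltr_wpDl.
- by rewrite lerDl.
exact: atomic_comb_atom.
Qed.

Section chain.
(** [R1] is the largest step of a chain. Two e-balls with centres at distance at most [R1] lie in
    one ball of radius [b], because [R1 + e <= b]; pairs farther apart than [R1] have approximate
    midpoints, because [R0 < R1]. *)
Variables (R0 R1 beta e : R).
Hypothesis beta_bnd : 0 < beta < 1.
Hypothesis R0_ge0 : 0 <= R0.
Hypothesis R01 : R0 < R1.
Hypothesis e_gt0 : 0 < e.
Hypothesis R1e : R1 + e <= b.
Hypothesis amp : approx_midpoint M R0 beta.

Local Notation bumpe x := (nindic mu (ball x e)).

Lemma bumpe_Lfun (x : M) : bumpe x \in Lfun mu r%:E.
Proof.
exact: (nindic_Lfun r_gt1 (borel_measurable_ball x e) (ball_fin x e_gt0)).1.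
Qed.

Lemma bumpe_int (x : M) :
  mu.-integrable setT (EFin \o bumpe x) /\ \int[mu]_z bumpe x z = 1.
Proof.
exact: (int_nindic r_gt1 conj_rr' (borel_measurable_ball x e) (ball_gt0 x e_gt0) (ball_fin x e_gt0)).
Qed.

Lemma bump_near (x y : M) : mdist x y <= R1 ->
  atomic_comb mu b r (fun z => bumpe x z - bumpe y z).
Proof.
move=> xy; have R1p := le_lt_trans R0_ge0 R01.
have b0 : 0 < b := lt_le_trans (addr_gt0 R1p e_gt0) R1e.
have bE : (fun z => bumpe x z - bumpe y z) = fun z => -1 * bumpe y z + bumpe x z.
  by apply/funext => z; rewrite mulN1r addrC.
have [ix ix1] := bumpe_int x; have [iy iy1] := bumpe_int y.
apply: (@mean_zero_comb x b); first by rewrite b0 lexx.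
- by rewrite bE; exact: (Lfun_lin (-1) r1 (bumpe_Lfun y) (bumpe_Lfun x)).1.
- move=> z nz; rewrite !nindic_out ?subrr//.
    move=> yz; apply: nz; apply: sub_ball yz.
    by apply: (le_trans _ R1e); rewrite lerD2r.
  move=> xz; apply: nz; apply: sub_ball xz; rewrite mdistxx add0r.
  by apply: (le_trans _ R1e); rewrite lerDr ltW.
- by rewrite RintegralB// ix1 iy1 subrr.
Qed.

(* Approximate midpoints cut a distance by the factor beta until it is at most
   R1, so normalised indicators of any two e-balls are linked by a chain. *)
Lemma bump_chain (x y : M) : atomic_comb mu b r (fun z => bumpe x z - bumpe y z).
Proof.
have [b0 b1] := andP beta_bnd.
have R1_gt0 : 0 < R1 := le_lt_trans R0_ge0 R01.
have main n : forall x y, mdist x y * beta ^+ n <= R1 ->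
    atomic_comb mu b r (fun z => bumpe x z - bumpe y z).
  elim: n => [|n IH] {}x {}y; first by rewrite expr0 mulr1; exact: bump_near.
  move=> xyn; have [xy|xy] := leP (mdist x y) R1; first exact: bump_near.
  have [|c [s [cx cy sb]]] := amp (x := x) (y := y); first exact: lt_trans xy.
  (* Both points are within [beta * mdist x y] of [c], so one power of [beta] is absorbed and the
     induction hypothesis applies to each half. *)
  have half z : ball c s z -> mdist c z * beta ^+ n <= R1.
    rewrite in_ball => cz; apply: le_trans xyn; rewrite exprS mulrA.
    rewrite ler_wpM2r ?exprn_ge0 ?(ltW b0)// mulrC.
    by apply: ltW; apply: lt_trans sb.
  have hx := IH c x (half x cx); have hy := IH c y (half y cy).
  have := atomic_comb_lin (-1) hx hy.
  rewrite (_ : (fun z => _) = (fun z => bumpe x z - bumpe y z))//.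
  by apply/funext => z; lra.
have [n] : exists n, mdist x y * beta ^+ n <= R1.
  have c0 : (fun n => mdist x y * beta ^+ n) @ \oo --> 0.
    rewrite -(mulr0 (mdist x y)); apply: cvgM; first exact: cvg_cst.
    by apply: cvg_expr; rewrite ger0_norm// ltW.
  have /cvgrPdist_le/(_ _ R1_gt0) [n _ /(_ n (leqnn n))] := c0.
  rewrite /= sub0r normrN => h; exists n; exact: le_trans (ler_norm _) h.
exact: main.
Qed.

Variables (l : (M -> R) -> R) (K : R).
Hypothesis K_ge0 : 0 <= K.
Hypothesis l_comb : forall (t : R) (g h : M -> R),
  atomic_comb mu b r g -> atomic_comb mu b r h ->
  l (fun x => t * g x + h x) = t * l g + l h.
Hypothesis l_atom : forall a, atom_le mu b r a -> `|l a| <= K.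

Lemma functional_comb0 : l (fun=> 0) = 0.
Proof.
have c0 := atomic_comb0 mu b r.
have : l (fun=> 0) = 1 * l (fun=> 0) + l (fun=> 0).
  by rewrite -(l_comb 1 c0 c0); congr l; apply/funext => x; rewrite mulr0 addr0.
rewrite mul1r.
by move/eqP; rewrite eq_sym -subr_eq0 addrK => /eqP.
Qed.

Lemma functional_mean_zero (c : M) (s : R) (v : M -> R) : 0 < s <= b ->
  v \in Lfun mu r%:E -> (forall x, ~ ball c s x -> v x = 0) -> \int[mu]_x v x = 0 ->
  `|l v| <= K * (Lrnorm mu r v * (fine (mu (ball c s))) `^ r'^-1).
Proof.
move=> sb vL v0 iv; set t := Lrnorm mu r v * _.
have t0 : 0 <= t by rewrite mulr_ge0 ?Lrnorm_ge0 ?powR_ge0.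
(* The scaling factor must be positive although [t] may vanish. The perturbation costs
   [K * ep / (K + 1) <= ep], so the bound stays sharp. *)
apply/ler_addgt0Pr => ep ep0; pose u := t + ep / (K + 1).
have K1 : 0 < K + 1 by rewrite ltr_wpDl.
have u0 : 0 < u by rewrite ltr_wpDl// divr_gt0.
have [|va vE] := mean_zero_scaled_atom sb vL v0 iv u0.
  by rewrite lerDl ltW// divr_gt0.
have -> : l v = u * l (fun x => u^-1 * v x).
  rewrite [in LHS]vE -[RHS]addr0 -functional_comb0 -l_comb.
  - by congr l; apply/funext => x; rewrite addr0.
  - rewrite (_ : (fun x => u^-1 * v x) = fun x => 1 * (u^-1 * v x)).
      exact: (atomic_comb_atom 1 va).
    by apply/funext => x; rewrite mul1r.
  - exact: atomic_comb0.
rewrite normrM (gtr0_norm u0) mulrC.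
apply: le_trans (ler_wpM2r (ltW u0) (l_atom va)) _.
rewrite /u mulrDr lerD2l mulrA -mulrAC ler_piMl//; first exact: ltW.
by rewrite ler_pdivrMr// mul1r lerDl.
Qed.

Variable x0 : M.

(* Split off the part of u on one e-ball: its mean-zero correction is a multiple
   of an atom, and its mean is transported to x0 along a chain. *)
Lemma cover_decomposition (xs : seq M) : exists2 C : R, 0 <= C & forall u,
  u \in Lfun mu r%:E -> (forall z, (forall x, x \in xs -> ~ ball x e z) -> u z = 0) ->
  let w := (fun z => u z - (\int[mu]_y u y) * bumpe x0 z) in
  [/\ mu.-integrable setT (EFin \o u), atomic_comb mu b r w & `|l w| <= C * Lrnorm mu r u].
Proof.
elim: xs => [|x xs [C C0 IH]].
  exists 0 => // u uL u0.
  have {u0}u0 : u = fun=> 0 by apply/funext => z; apply: u0.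
  rewrite u0 /= Rintegral_cst// mul0r.
  rewrite (_ : (fun z => _) = fun=> 0); last first.
    by apply/funext => z; rewrite mul0r subrr.
  rewrite functional_comb0 normr0 mul0r; split => //; last exact: atomic_comb0.
  exact: integrable0.
set B : set M := ball x e; set mB := (fine (mu B)) `^ r'^-1.
have measB : measurable B := borel_measurable_ball x e.
have eb : 0 < e <= b.
  by rewrite e_gt0 (le_trans _ R1e)// lerDr ltW// (le_lt_trans R0_ge0 R01).
have mB0 : 0 <= mB by exact: powR_ge0.
pose L := `|l (fun z => bumpe x z - bumpe x0 z)|.
(* The three terms bound [l] on the mean-zero part over [B], on the transport of its mean from [x]
   to [x0], and on the remainder carried by the other balls. *)
exists (K * 2 * mB + mB * L + C).
  by rewrite !addr_ge0 ?mulr_ge0 ?normr_ge0.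
move=> u uL u0.
have [u1L u1N] := Lfun_restr r0 measB uL.
have [u2L u2N] := Lfun_restr r0 (measurableC measB) uL.
have u1out z : ~ B z -> (u \_ B) z = 0 by move=> Bz; rewrite patchE memNset.
have [iu1 u1le] := supp_Lfun_integrable r_gt1 conj_rr' measB (ball_fin x e_gt0) u1L u1out.
have [z nz|iu2 w2c w2le] := IH _ u2L.
  rewrite patchE; case: ifPn => // /set_mem Bz; apply: u0 => y.
  by rewrite inE => /orP[/eqP->|]//; exact: nz.
have uE : u = fun z => (u \_ B) z + (u \_ (~` B)) z.
  apply/funext => z; rewrite !patchE in_setC.
  by case: (z \in B); rewrite /= ?addr0 ?add0r.
have [cL cout cint cN] := centered_Lfun r_gt1 conj_rr' measB (ball_gt0 x e_gt0)
  (ball_fin x e_gt0) u1L u1out.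
have cc := mean_zero_comb eb cL cout cint.
have cle := functional_mean_zero eb cL cout cint.
have iuE : \int[mu]_y u y = \int[mu]_y (u \_ B) y + \int[mu]_y (u \_ (~` B)) y.
  by rewrite -RintegralD// -uE.
have bc := bump_chain x x0.
move=> w.
have wE : w = fun z => 1 * centered mu B (u \_ B) z +
   ((\int[mu]_y (u \_ B) y) * (bumpe x z - bumpe x0 z) +
    ((u \_ (~` B)) z - (\int[mu]_y (u \_ (~` B)) y) * bumpe x0 z)).
  apply/funext => z; rewrite /w iuE {1}uE /centered -/B mul1r.
  rewrite mulrDl mulrBr; lra.
split.
- have := integrableD measurableT iu1 iu2.
  rewrite (_ : (_ \+ _)%E = EFin \o u)//.
  by apply/funext => z /=; rewrite [in RHS]uE.
- rewrite wE; apply: atomic_comb_lin => //; exact: atomic_comb_lin.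
- rewrite wE l_comb//; last exact: atomic_comb_lin.
  rewrite l_comb// mul1r !mulrDl.
  apply: le_trans (ler_normD _ _) _; rewrite -addrA; apply: lerD.
    apply: le_trans cle _; rewrite -!mulrA ler_wpM2l//.
    rewrite -/B -/mB [leLHS]mulrC [leRHS]mulrCA ler_wpM2l// (le_trans cN)//.
    by rewrite ler_wpM2l.
  apply: le_trans (ler_normD _ _) _; apply: lerD.
    rewrite normrM -/L mulrAC ler_wpM2r ?normr_ge0//.
    by apply: le_trans u1le _; rewrite mulrC ler_wpM2l.
  by apply: le_trans w2le _; rewrite ler_wpM2l.
Qed.

End chain.
End decomposition.

(** Densities are found on the disjoint layers between consecutive sets rather than on the sets
    themselves, so they are glued by addition and no almost-everywhere uniqueness is needed to match
    them. The bound on [Lam] may depend on [n]. *)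
Lemma riesz_exhaustion d (T : measurableType d) (R : realType)
    (mu : {measure set T -> \bar R}) (r r' : R) (E : (set T)^nat)
    (Lam : (T -> R) -> R) :
  1 < r -> r^-1 + r'^-1 = 1 -> sigma_finite setT mu ->
  (forall n, measurable (E n)) -> (forall n, (mu (E n) < +oo)%E) -> E 0%N = set0 ->
  (forall n, E n `<=` E n.+1) ->
  (forall n (t : R) u v, u \in Lfun mu r%:E -> v \in Lfun mu r%:E ->
     (forall x, ~ E n x -> u x = 0) -> (forall x, ~ E n x -> v x = 0) ->
     Lam (fun x => t * u x + v x) = t * Lam u + Lam v) ->
  (forall n, exists2 C : R, 0 <= C & forall u, u \in Lfun mu r%:E ->
     (forall x, ~ E n x -> u x = 0) -> `|Lam u| <= C * Lrnorm mu r u) ->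
  exists f : T -> R, (forall n, f \_ (E n) \in Lfun mu r'%:E) /\
    forall n u, u \in Lfun mu r%:E -> (forall x, ~ E n x -> u x = 0) ->
      Lam u = \int[mu]_x (f x * u x).
Proof.
move=> r_gt1 conj_rr' sf mE Eoo E0 ndE Lin Bnd.
have r0 : 0 < r := lt_trans ltr01 r_gt1; have r1 := ltW r_gt1.
have r'1 := conjugate_gt1 r_gt1 conj_rr'; have r'0 : 0 < r' := lt_trans ltr01 r'1.
pose D k := E k.+1 `\` E k.
have mD k : measurable (D k) by exact: measurableD.
have Doo k : (mu (D k) < +oo)%E.
  apply: le_lt_trans (Eoo k.+1); apply: le_measure; rewrite ?inE//.
  exact: subDsetl.
have outD k (u : T -> R) x : ~ E k.+1 x -> (u \_ (D k)) x = 0.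
  by move=> Ex; rewrite patchE memNset// => -[].
have loc k : exists f : T -> R,
  [/\ f \in Lfun mu r'%:E, (forall x, ~ D k x -> f x = 0) &
   forall u, u \in Lfun mu r%:E -> Lam (u \_ (D k)) = \int[mu]_x (f x * u x)].
  have [C C0 HC] := Bnd k.+1.
  have [||f [fL f0 fE]] := @riesz_finite_measure _ _ _ mu r r' C
      (fun u => Lam (u \_ (D k))) (D k) r_gt1 conj_rr' sf C0 _ _ (mD k) (Doo k).
  - move=> t u v uL vL; rewrite -(Lin k.+1); last 2 first.
    - exact: outD.
    - exact: outD.
    - congr Lam; apply/funext => x; rewrite !patchE; case: ifP => // _.
      by rewrite mulr0 addr0.
    - exact: (Lfun_restr r0 (mD k) uL).1.
    - exact: (Lfun_restr r0 (mD k) vL).1.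
  - move=> u uL; have [uDL uDN] := Lfun_restr r0 (mD k) uL.
    by apply: le_trans (HC _ uDL (outD k u)) _; rewrite ler_wpM2l.
  exists f; split => // u uL; rewrite -fE//; congr Lam.
  by apply/funext => x; rewrite !patchE; case: ifP.
have [F HF] := choice loc.
pose S n x := \sum_(k < n) F k x.
(* Layers of index [n] or more are disjoint from [E n], so they add nothing there. *)
have Sstep n m x : E n x -> (n <= m)%N -> S m x = S n x.
  move=> Enx; elim: m => [|m IH]; first by rewrite leqn0 => /eqP ->.
  rewrite leq_eqVlt => /predU1P[->//|]; rewrite ltnS => nm.
  rewrite /S big_ord_recr/= -/(S m x) IH//.
  have Emx : E m x.
    elim: m nm {IH} => [|m IHm]; first by rewrite leqn0 => /eqP <-.
    by rewrite leq_eqVlt => /predU1P[<-//|]; rewrite ltnS => /IHm/ndE.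
  by have [_ Fm0 _] := HF m; rewrite Fm0 ?addr0// => -[].
have Sout n x : ~ E n x -> S n x = 0.
  elim: n => [|n IH] Ex; first by rewrite /S big_ord0.
  rewrite /S big_ord_recr/= -/(S n x) IH ?add0r; last by move=> /ndE.
  by have [_ Fn0 _] := HF n; apply: Fn0 => -[].
have SL n : S n \in Lfun mu r'%:E.
  by apply: Lfun_sum => //; [exact: ltW|move=> i; have [] := HF i].
have SLam n u : u \in Lfun mu r%:E -> (forall x, ~ E n x -> u x = 0) ->
    Lam u = \int[mu]_x (S n x * u x).
  elim: n u => [|n IH] u uL u0.
    have -> : u = fun=> 0 by apply/funext => x; apply: u0; rewrite E0.
    under eq_Rintegral do rewrite mulr0.
    rewrite Rintegral_cst// mul0r.
    have [z zN] := Lfun0 mu r0; have [C C0 HC] := Bnd 0%N.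
    apply/eqP; rewrite -normr_le0; apply: le_trans (HC _ z _) _ => //.
    by rewrite zN mulr0.
  have [uDL _] := Lfun_restr r0 (mD n) uL.
  have [uEL _] := Lfun_restr r0 (mE n) uL.
  have uEout x : ~ E n x -> (u \_ (E n)) x = 0 by move=> Ex; rewrite patchE memNset.
  have [FnL Fn0 FnE] := HF n.
  have -> : Lam u = 1 * Lam (u \_ (D n)) + Lam (u \_ (E n)).
    rewrite -(Lin n.+1)//; last 2 first.
    - exact: outD.
    - by move=> x Ex; apply: uEout => /ndE.
    congr Lam; apply/funext => x; rewrite !patchE mul1r.
    have [Ex|Ex] := pselect (E n x).
      by rewrite (mem_set Ex) memNset ?add0r// => -[].
    rewrite (memNset Ex) addr0.
    have [Dx|Dx] := pselect (D n x); first by rewrite mem_set.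
    rewrite memNset//; apply: u0 => E1x; apply: Dx; split => //.
  rewrite mul1r FnE// IH// -RintegralD//; last 2 first.
  - by apply: (hoelder_int r'0 r0 _ FnL uL).1; rewrite addrC.
  - by apply: (hoelder_int r'0 r0 _ (SL n) uEL).1; rewrite addrC.
  apply: eq_Rintegral => x _; rewrite /S big_ord_recr/= -/(S n x) mulrDl addrC.
  congr (_ + _); rewrite patchE; case: ifPn => // /negP Ex.
  by rewrite (Sout n) ?mul0r// => /mem_set.
(* At each point the partial sums are eventually constant. *)
pose f x := limn (fun n => S n x).
have fS n x : E n x -> f x = S n x.
  move=> Ex; rewrite /f; apply: lim_near_cst => //.
  by exists n => // m /= nm; exact: Sstep.
exists f; split.
- move=> n; rewrite (_ : f \_ (E n) = S n)//; apply/funext => x.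
  rewrite patchE; case: ifPn => [/set_mem /fS//|/negP Ex].
  by rewrite Sout// => /mem_set.
- move=> n u uL u0; rewrite (SLam n)//; apply: eq_Rintegral => x _.
  have [Ex|Ex] := pselect (E n x); first by rewrite (fS n).
  by rewrite u0// !mulr0.
Qed.

(** * From functionals to BMO *)

Section duality.
Context {d : measure_display} {R : realType} {M : borelMetricType d R}.
Variables (mu : {measure set M -> \bar R}) (b r r' : R).
Hypothesis r_gt1 : 1 < r.
Hypothesis conj_rr' : r^-1 + r'^-1 = 1.
Hypothesis mu_gt0 : (0 < mu [set: M])%E.
Hypothesis ball_fin : forall (c : M) (s : R), 0 < s -> (mu (ball c s) < +oo)%E.
Hypothesis ldp : local_doubling mu.

Let r0 : 0 < r := lt_trans ltr01 r_gt1.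
Let r1 : 1 <= r := ltW r_gt1.
Let r'1 : 1 < r' := conjugate_gt1 r_gt1 conj_rr'.
Let r'0 : 0 < r' := lt_trans ltr01 r'1.
Let ball_gt0 := mu_ball_gt0 mu_gt0 ldp.
Let ballM := @borel_measurable_ball d R M.
Let x0 : M := point.

Lemma ball_sub_nat (c : M) (s : R) : exists n, ball c s `<=` ball x0 n%:R.
Proof.
exists (Num.truncn (mdist x0 c + s)).+1; apply: sub_ball; apply: ltW.
exact: truncnS_gt.
Qed.

Lemma ball_nat_le (m n : nat) : (m <= n)%N -> ball x0 m%:R `<=` ball x0 n%:R.
Proof. by move=> mn; apply: le_ball; rewrite ler_nat. Qed.

Lemma ball_nat0 : ball x0 0%:R = set0.
Proof.
apply/seteqP; split => // y; rewrite in_ball => /lt_le_trans h.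
by have := h _ (mdist_ge0 x0 y); rewrite ltxx.
Qed.

Lemma ball_nat_fin (n : nat) : (mu (ball x0 n%:R) < +oo)%E.
Proof.
case: n => [|n]; first by rewrite ball_nat0 measure0.
exact: ball_fin.
Qed.

Lemma measurable_fun_balls (f : M -> R) :
  (forall n, measurable_fun (ball x0 n%:R) f) -> measurable_fun setT f.
Proof.
move=> mf; rewrite -(bigcup_ball x0).
by apply/measurable_fun_bigcup => // n; exact: ballM.
Qed.

Definition bounded_Lr (n : nat) (u : M -> R) : Prop :=
  u \in Lfun mu r%:E /\ forall x, ~ ball x0 n%:R x -> u x = 0.

Lemma bounded_Lr_int (n : nat) (u : M -> R) : bounded_Lr n u ->
  mu.-integrable setT (EFin \o u).
Proof.
move=> [uL u0].
exact: (supp_Lfun_integrable r_gt1 conj_rr' (ballM x0 _) (ball_nat_fin n) uL u0).1.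
Qed.

(** The atoms of [hardy_fin] sit on balls of any radius and vanish off them only almost everywhere.
    Cutting each one off gives a function with true bounded support, to which the Riesz
    representation applies. *)
Lemma hardy_fin_restr (g : M -> R) : hardy_fin mu r g ->
  mu.-integrable setT (EFin \o g) /\
  exists n g', [/\ bounded_Lr n g', \int[mu]_x g' x = 0 & {ae mu, forall x, g x = g' x}].
Proof.
move=> [n [lam [a [ha gE]]]]; elim: n lam a g ha gE => [|n IH] lam a g ha gE.
  have g0 x : g x = 0 by rewrite gE big_ord0.
  rewrite (funext g0).
  split; first exact: integrable0.
  exists 0%N, (fun=> 0); split.
  - by split => //; exact: (Lfun0 mu r0).1.
  - by rewrite Rintegral_cst// mul0r.
  - exact: aeW.
pose h x := \sum_(i < n) lam (lift ord0 i) * a (lift ord0 i) x.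
have {}gE x : g x = lam ord0 * a ord0 x + h x by rewrite gE big_ord_recl.
have [//|//|ih [m [h' [[h'L h'0] ih' hh']]]] :=
  IH (fun i => lam (lift ord0 i)) (fun i => a (lift ord0 i)) h.
have [c [s [s0 atom0]]] := ha ord0.
have [ia _ _ _] := atom0.
have [aL a0 ia0 aa' _] := atom_restr r_gt1 conj_rr' ball_gt0 ball_fin s0 atom0.
split.
  have := integrableD measurableT (integrableZl measurableT (lam ord0) ia) ih.
  by apply: eq_integrable => // x _ /=; rewrite gE.
have [k ck] := ball_sub_nat c s.
have [L _] := Lfun_lin (lam ord0) r1 aL h'L.
have ia' := (supp_Lfun_integrable r_gt1 conj_rr' (ballM c s) (ball_fin c s0) aL a0).1.
exists (maxn k m), (fun x => lam ord0 * (a ord0 \_ (ball c s)) x + h' x); split.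
- split => // x nx; rewrite a0 ?h'0 ?mulr0 ?addr0//.
    by move=> /(ball_nat_le (leq_maxr k m)).
  by move=> /ck /(ball_nat_le (leq_maxl k m)).
- rewrite RintegralD//; last 2 first.
  + exact: (integrableZl _ (lam ord0) ia').
  + exact: bounded_Lr_int (conj h'L h'0).
  by rewrite RintegralZl// ia0 ih' mulr0 addr0.
- by apply: filterS2 aa' hh' => x ax hx; rewrite gE ax hx.
Qed.

Lemma integral_bounded_ball (f u : M -> R) (n : nat) :
  f \_ (ball x0 n%:R) \in Lfun mu r'%:E -> bounded_Lr n u ->
  mu.-integrable setT (EFin \o (fun x => f x * u x)) /\
  \int[mu]_x (f x * u x) = \int[mu]_x ((f \_ (ball x0 n%:R)) x * u x).
Proof.
move=> fL [uL u0].
have e : (fun x => f x * u x) = fun x => (f \_ (ball x0 n%:R)) x * u x.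
  apply/funext => x; rewrite patchE; case: ifPn => // /negP nx.
  by rewrite u0 ?mulr0// => /mem_set.
rewrite e; split => //.
by apply: (hoelder_int r'0 r0 _ fL uL).1; rewrite addrC.
Qed.

(** Testing [f - f_B] against [u] is the same as testing [f] against the mean-zero correction of
    [u], which the hypothesis controls. The converse of Hoelder's inequality then bounds the
    oscillation on [B]. *)
Lemma bmo_from_functional (f : M -> R) (K : R) : 0 <= K ->
  (forall n, f \_ (ball x0 n%:R) \in Lfun mu r'%:E) ->
  (forall c s (u : M -> R), 0 < s <= b -> u \in Lfun mu r%:E ->
     (forall x, ~ ball c s x -> u x = 0) -> \int[mu]_x u x = 0 ->
     `|\int[mu]_x (f x * u x)| <= K * (Lrnorm mu r u * (fine (mu (ball c s))) `^ r'^-1)) ->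
  locally_integrable_balls mu f /\ (bmo_norm mu b r' f <= (2 * K)%:E)%E.
Proof.
move=> K0 fL H.
have loc : locally_integrable_balls mu f.
  move=> c s s0; have [n cn] := ball_sub_nat c s.
  have cj : r'^-1 + r^-1 = 1 by rewrite addrC.
  have [i _] := hoelder_set r'0 r0 cj (ballM x0 n%:R) (ball_nat_fin n) (fL n).
  have i' : mu.-integrable (ball x0 n%:R) (EFin \o f).
    apply: eq_integrable i => // x xn /=.
    by rewrite patchE xn.
  exact: integrableS (ballM x0 n%:R) (ballM c s) cn i'.
split => //; apply: ub_ereal_sup => _ [c [s [sb ->]]].
have s0 : 0 < s by case/andP: sb.
set B : set M := ball c s.
have mB : measurable B := ballM c s.
pose m := fine (mu B).
have m0 : 0 < m by rewrite fine_gt0// ball_gt0//= ball_fin.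
pose av := average mu B f.
have [n cn] := ball_sub_nat c s.
(* Cutting [f] to a large ball gives the global measurability that [converse_hoelder] asks for, and
   changes nothing on [B]. *)
pose h x := (f \_ (ball x0 n%:R)) x - av.
have fB x : B x -> (f \_ (ball x0 n%:R)) x = f x.
  by move=> Bx; rewrite patchE mem_set//; exact: cn.
have mh : measurable_fun setT h.
  by apply: measurable_funB => //; exact: Lfun_meas (fL n).
have icst : mu.-integrable B (EFin \o (fun=> av)).
  apply: measurable_bounded_integrable => //; first exact: ball_fin.
  by exists `|av|; split; [exact: num_real|move=> l al x _ /=; exact: ltW].
have ih : mu.-integrable B (EFin \o h).
  have := integrableB mB (loc c s s0) icst.
  apply: eq_integrable => // x /set_mem Bx /=.
  by rewrite /h fB// EFinB.
have mr0 : 0 <= m `^ r'^-1 := powR_ge0 _ _.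
(* The power of [m] is cancelled at the end by the factor [m^-1] inside [Lq_mean], leaving
   [2 * K]. *)
pose K' := 2 * K * m `^ r'^-1.
have K'0 : 0 <= K' by rewrite !mulr_ge0.
have := @converse_hoelder _ _ _ mu r r' K' B h r_gt1 conj_rr' mB (ball_fin c s0) mh ih K'0.
have -> : (\int[mu]_(x in B) (`|h x| `^ r')%:E =
           \int[mu]_(x in B) (`|f x - av| `^ r')%:E)%E.
  by apply: eq_integral => x /set_mem Bx; rewrite /h fB.
move=> conv; rewrite /Lq_mean -/av -/m.
have {}conv := conv _.
apply: (@le_trans _ _ (((m^-1)%:E * (K' `^ r')%:E) `^ r'^-1)%E).
  rewrite gt0_ler_poweR ?invr_ge0 ?(ltW r'0)//.
  - rewrite in_itv/= leey andbT mule_ge0// ?lee_fin ?invr_ge0 ?(ltW m0)//.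
    by apply: integral_ge0 => x _; rewrite lee_fin powR_ge0.
  - by rewrite in_itv/= leey andbT mule_ge0// ?lee_fin ?invr_ge0 ?(ltW m0) ?powR_ge0.
  rewrite lee_wpmul2l ?lee_fin ?invr_ge0 ?(ltW m0)//.
  apply: conv => u uL u0 ihu.
  have [iu _] := supp_Lfun_integrable r_gt1 conj_rr' mB (ball_fin c s0) uL u0.
  have [cL cout cint cN] := centered_Lfun r_gt1 conj_rr' mB (ball_gt0 c s0) (ball_fin c s0) uL u0.
  have bL : nindic mu B \in Lfun mu r%:E := (nindic_Lfun r_gt1 mB (ball_fin c s0)).1.
  have bb : bounded_Lr n (nindic mu B).
    by split => // x nx; rewrite nindic_out// => /cn.
  have ub : bounded_Lr n u by split => // x nx; apply: u0 => /cn.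
  have [ifu _] := integral_bounded_ball (fL n) ub.
  have [ifb _] := integral_bounded_ball (fL n) bb.
  have eav : \int[mu]_x (f x * nindic mu B x) = av.
    rewrite /av /average -/m -RintegralZl//; last exact: loc.
    rewrite [RHS]Rintegral_mkcond; apply: eq_Rintegral => x _.
    rewrite patchE /nindic indicE -/m mulrCA; case: (x \in B); rewrite ?mulr1//.
    by rewrite !mulr0.
  have -> : \int[mu]_(x in B) (h x * u x) = \int[mu]_x (f x * centered mu B u x).
    have e1 : \int[mu]_(x in B) (h x * u x) = \int[mu]_x (f x * u x - av * u x).
      rewrite Rintegral_mkcond; apply: eq_Rintegral => x _; rewrite patchE.
      have [Bx|Bx] := pselect (B x); first by rewrite mem_set// /h fB// mulrBl.
      by rewrite memNset// u0// !mulr0 subrr.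
    rewrite e1 RintegralB//; last exact: (integrableZl _ av iu).
    rewrite RintegralZl//.
    have -> : \int[mu]_x (f x * centered mu B u x) =
        \int[mu]_x (f x * u x - (\int[mu]_y u y) * (f x * nindic mu B x)).
      by apply: eq_Rintegral => x _; rewrite /centered mulrBr mulrCA.
    rewrite RintegralB//; last exact: (integrableZl _ _ ifb).
    by rewrite RintegralZl// eav mulrC.
  apply: le_trans (H _ _ _ sb cL cout cint) _.
  apply: (@le_trans _ _ (K * (2 * Lrnorm mu r u * m `^ r'^-1))).
    by rewrite ler_wpM2l// ler_wpM2r.
  by rewrite /K'; lra.
rewrite -EFinM poweR_EFin lee_fin powRM ?invr_ge0 ?(ltW m0) ?powR_ge0//.
rewrite -powRrM mulfV ?gt_eqF// powRr1// /K'.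
rewrite -(powR_inv1 (ltW m0)) -powRrM mulN1r powRN.
by rewrite mulrC mulfK// gt_eqF// powR_gt0.
Qed.

Variables (R0 beta : R).
Hypothesis beta_bnd : 0 < beta < 1.
Hypothesis R0_ge0 : 0 <= R0.
Hypothesis R0b : R0 < b.
Hypothesis amp : approx_midpoint M R0 beta.

Theorem dual_to_bmo (l : (M -> R) -> R) :
  hardy_linear mu b r l -> hardy_continuous mu b r l ->
  exists f : M -> R,
    [/\ bmo mu b r' f, (bmo_norm mu b r' f <= 2%:E * dual_norm mu b r l)%E &
      forall g, hardy_fin mu r g -> (l g)%:E = (\int[mu]_x (f x * g x)%:E)%E].
Proof.
move=> l_lin l_cont.
have b0 : 0 < b := le_lt_trans R0_ge0 R0b.
have [K K0 lK] := dual_norm_fin r_gt1 conj_rr' ball_gt0 ball_fin b0 l_lin l_cont.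
have l_atom a : atom_le mu b r a -> `|l a| <= K :=
  dual_norm_atom lK.
have l_comb t g h : atomic_comb mu b r g -> atomic_comb mu b r h ->
    l (fun x => t * g x + h x) = t * l g + l h.
  exact: (hardy_linear_comb r_gt1 conj_rr' ball_gt0 ball_fin b0 l_lin).
(* The gap between [R0] and [b] is halved: [R1] exceeds [R0], and [R1 + e] is exactly [b]. *)
pose R1 := (R0 + b) / 2; pose e := (b - R0) / 2.
have R01 : R0 < R1 by rewrite /R1; have := R0b; lra.
have e0 : 0 < e by rewrite /e; have := R0b; lra.
have R1e : R1 + e <= b by rewrite /R1 /e; lra.
(* [l] matters only on [hardy], whose elements have integral zero. The correction extends it to all
   L^r functions of bounded support, and [Lam u] is [l u] when [u] already has mean zero. *)
pose Lam u := l (fun z => u z - (\int[mu]_y u y) * nindic mu (ball x0 e) z).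
have dec n : exists2 C : R, 0 <= C & forall u, bounded_Lr n u ->
    atomic_comb mu b r (fun z => u z - (\int[mu]_y u y) * nindic mu (ball x0 e) z) /\
    `|Lam u| <= C * Lrnorm mu r u.
  (* The ball of radius 0 is empty and is treated apart, since [ball_cover] needs a positive
     radius. *)
  have [xs cov] : exists xs : seq M, forall y, ball x0 n%:R y ->
      exists2 x, x \in xs & ball x e y.
    case: n => [|n]; first by exists [::] => y; rewrite ball_nat0.
    by apply: (ball_cover mu_gt0 ball_fin ldp).
  have [C C0 HC] := cover_decomposition r_gt1 conj_rr' ball_gt0 ball_fin beta_bnd
    R0_ge0 R01 e0 R1e amp K0 l_comb l_atom x0 xs.
  exists C => // u [uL u0]; have [z nz|_ uc ule] := HC u uL.
    by apply: u0 => /cov[x xxs xz]; exact: nz xz.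
  by [].
have [||||||f [fL fE]] := @riesz_exhaustion _ _ _ mu r r' (fun n => ball x0 n%:R) Lam
  r_gt1 conj_rr' (sigma_finite_balls ball_fin).
- by move=> n; exact: ballM.
- exact: ball_nat_fin.
- exact: ball_nat0.
- by move=> n; apply: ball_nat_le.
- move=> n t u v uL vL u0 v0.
  have [C _ HC] := dec n.
  have iu := bounded_Lr_int (conj uL u0); have iv := bounded_Lr_int (conj vL v0).
  have [uc _] := HC u (conj uL u0); have [vc _] := HC v (conj vL v0).
  rewrite /Lam -l_comb//; congr l; apply/funext => z.
  rewrite RintegralD//; last exact: (integrableZl _ t iu).
  by rewrite RintegralZl//; lra.
- move=> n; have [C C0 HC] := dec n; exists C => // u uL u0.
  by have [] := HC u (conj uL u0).
have repr n u : bounded_Lr n u -> \int[mu]_x u x = 0 ->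
    atomic_comb mu b r u /\ l u = \int[mu]_x (f x * u x).
  move=> [uL u0] iu; have [C _ HC] := dec n; have [+ _] := HC u (conj uL u0).
  have uE : (fun z => u z - (\int[mu]_y u y) * nindic mu (ball x0 e) z) = u.
    by apply/funext => z; rewrite iu mul0r subr0.
  by rewrite uE -(fE n)// /Lam uE.
(* Only the bound [K] on b-atoms enters here; the ball-dependent constants of [dec] leave no trace
   in the BMO norm. *)
have [|loc fN] := bmo_from_functional K0 fL (f := f).
  move=> c s u sb uL u0 iu; have [n cn] := ball_sub_nat c s.
  have ub : bounded_Lr n u by split => // x nx; apply: u0 => /cn.
  have [_ <-] := repr n u ub iu.
  exact: (functional_mean_zero r_gt1 conj_rr' ball_gt0 ball_fin K0 l_comb l_atom sb uL u0 iu).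
exists f; split.
- by split => //; exact: le_lt_trans fN (ltry _).
- by rewrite lK -EFinM.
- move=> g /hardy_fin_restr[ig [n [g' [g'b ig' gg']]]].
  have [g'c lg'] := repr n g' g'b ig'.
  have g'h := atomic_comb_hardy r_gt1 conj_rr' ball_gt0 ball_fin b0 g'c.
  (* [l] respects almost-everywhere equality only within [hardy]. As the atoms of [g] may sit on
     large balls, its membership is deduced from that of [g']. *)
  have gh := hardy_ae g'h ig gg'.
  rewrite (l_lin.1 _ _ gh g'h gg') lg'.
  have [ifg _] := integral_bounded_ball (fL n) g'b.
  rewrite /Rintegral fineK; last exact: integrable_fin_num ifg.
  have mg' : measurable_fun setT (fun x => (f x * g' x)%:E) := measurable_int _ ifg.
  apply: ae_eq_integral => //; last by apply: filterS gg' => x -> _.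
  apply/measurable_EFinP/measurable_funM.
    apply: measurable_fun_balls => k; apply/(measurable_restrictT _ (ballM x0 k%:R)).
    exact: Lfun_meas (fL _).
  by apply/measurable_EFinP; exact: measurable_int ig.
Qed.

End duality.

(** * From BMO to functionals *)

(** Compactness of the segment gives a cluster point. Along an ultrafilter it is a limit, because
    each neighbourhood or its complement has its preimage in [U], and the complement cannot. *)
Lemma ultra_bounded_cvg (R : realType) (T : Type) (U : set_system T) (S : T -> R) (C : R) :
  UltraFilter U -> (forall n, `|S n| <= C) -> cvg (S @ U).
Proof.
move=> FU SC; have PU : ProperFilter U := @ultra_proper _ _ FU.
have [|p [_ clp]] := @segment_compact R (- C) C (S @ U) _.
  apply: (@filterE _ U) => n /=; rewrite in_itv/= -ler_norml; exact: SC.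
apply/cvg_ex; exists p => V pV.
have [//|nV] := in_ultra_setVsetC (S @^-1` V) FU.
by have [q [nq Vq]] := clp (~` V) V nV pV.
Qed.

Section clip.
Context {R : realType}.
Implicit Types (n : nat) (t u : R).

Definition clip n t : R := Num.max (- n%:R) (Num.min t n%:R).

Lemma clip_le n t : `|clip n t| <= n%:R.
Proof.
have : 0 <= n%:R :> R by [].
rewrite /clip; move: (n%:R : R) => c c0; rewrite ler_norml.
by case: (leP t c) => ?; [case: (leP (- c) t)|case: (leP (- c) c)] => ?;
  apply/andP; split; lra.
Qed.

Lemma clip_lipschitz n t u : `|clip n t - clip n u| <= `|t - u|.
Proof.
rewrite /clip.
have : 0 <= n%:R :> R by [].
move: (n%:R : R) => c c0; rewrite ler_norml.
have /andP[h1 h2] : - `|t - u| <= t - u <= `|t - u| by rewrite -ler_norml.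
have h0 : 0 <= `|t - u| by [].
by case: (leP t c) => ?; [case: (leP (- c) t)|case: (leP (- c) c)] => ?;
  (case: (leP u c) => ?; [case: (leP (- c) u)|case: (leP (- c) c)] => ?);
  apply/andP; split; lra.
Qed.

Lemma clip_id n t : `|t| <= n%:R -> clip n t = t.
Proof.
rewrite ler_norml => /andP[h1 h2].
by rewrite /clip (min_idPl h2) (max_idPr h1).
Qed.

Lemma clip_norm_le n t : `|clip n t| <= `|t|.
Proof.
have := clip_lipschitz n t 0; rewrite subr0 (_ : clip n 0 = 0) ?subr0//.
by apply: clip_id; rewrite normr0.
Qed.

Lemma clip_cvg t : clip n t @[n --> \oo] --> t.
Proof.
apply: cvg_near_cst; exists (Num.truncn `|t|).+1 => // n /= tn.
apply: clip_id; apply/ltW/(lt_le_trans (truncnS_gt _)).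
by rewrite ler_nat.
Qed.

Lemma measurable_clip d (T : measurableType d) n (f : T -> R) D : 
  measurable_fun D f -> measurable_fun D (clip n \o f).
Proof.
by move=> mf; apply: measurable_maxr => //; exact: measurable_minr.
Qed.

End clip.

Section bmo_functional.
Context {d : measure_display} {R : realType} {M : borelMetricType d R}.
Variables (mu : {measure set M -> \bar R}) (b r r' : R).
Hypothesis r_gt1 : 1 < r.
Hypothesis conj_rr' : r^-1 + r'^-1 = 1.
Hypothesis mu_gt0 : (0 < mu [set: M])%E.
Hypothesis ball_fin : forall (c : M) (s : R), 0 < s -> (mu (ball c s) < +oo)%E.
Hypothesis ldp : local_doubling mu.
Hypothesis b_gt0 : 0 < b.
Variable f : M -> R.
Hypothesis bmo_f : bmo mu b r' f.

Let r0 : 0 < r := lt_trans ltr01 r_gt1.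
Let r1 : 1 <= r := ltW r_gt1.
Let r'1 : 1 < r' := conjugate_gt1 r_gt1 conj_rr'.
Let r'0 : 0 < r' := lt_trans ltr01 r'1.
Let conj_r'r : r'^-1 + r^-1 = 1. Proof. by rewrite addrC. Qed.
Let ball_gt0 := mu_ball_gt0 mu_gt0 ldp.
Let ballM := @borel_measurable_ball d R M.
Let N := fine (bmo_norm mu b r' f).

Lemma bmo_norm_ge0 : (0 <= bmo_norm mu b r' f)%E.
Proof.
apply: (@le_trans _ _ (Lq_mean mu r' (ball (point : M) b)
          (fun x => f x - average mu (ball (point : M) b) f))).
  exact: poweR_ge0.
by apply: ereal_sup_ubound; exists point, b; rewrite b_gt0 lexx.
Qed.

Lemma bmo_normE : bmo_norm mu b r' f = N%:E.
Proof. by rewrite /N fineK// ge0_fin_numE ?bmo_norm_ge0//; case: bmo_f. Qed.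

Let N0 : 0 <= N. Proof. by rewrite fine_ge0// bmo_norm_ge0. Qed.

Lemma measurable_bmo : measurable_fun setT f.
Proof.
apply: measurable_fun_balls => -[|n].
  by rewrite ball_nat0; exact: measurable_fun_set0.
have [loc _] := bmo_f; apply/measurable_EFinP.
exact: measurable_int (loc point n.+1%:R _).
Qed.

Definition oscillation (c : M) (s : R) : M -> R :=
  (fun x => f x - average mu (ball c s) f) \_ (ball c s).

Lemma oscillation_Lfun (c : M) (s : R) : 0 < s <= b ->
  oscillation c s \in Lfun mu r'%:E /\
  Lrnorm mu r' (oscillation c s) <= N * (fine (mu (ball c s))) `^ r'^-1.
Proof.
move=> sb; have s0 : 0 < s by case/andP: sb.
pose av := average mu (ball c s) f; set m := fine (mu (ball c s)).
have m0 : 0 < m by rewrite fine_gt0// ball_gt0//= ball_fin.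
pose I := (\int[mu]_(x in ball c s) (`|f x - av| `^ r')%:E)%E.
have I0 : (0 <= I)%E by apply: integral_ge0 => x _; rewrite lee_fin powR_ge0.
have hN : (Lq_mean mu r' (ball c s) (fun x => (f x - av)%R) <= N%:E)%E.
  by rewrite -bmo_normE; apply: ereal_sup_ubound; exists c, s.
have hI : (I <= (m * N `^ r')%:E)%E.
  have : (((m^-1)%:E * I) `^ r'^-1 <= N%:E)%E by exact: hN.
  move=> /(gt0_ler_poweR (ltW r'0)); rewrite !in_itv/= !leey !andbT.
  rewrite poweR_ge0 lee_fin => /(_ isT N0).
  rewrite -poweRrM mulVf ?gt_eqF// poweRe1; last first.
    by rewrite mule_ge0// lee_fin invr_ge0 ltW.
  by rewrite lee_pdivrMl// EFinM.
have eI : (\int[mu]_x (`|oscillation c s x| `^ r')%:E = I)%E.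
  rewrite /I [RHS]integral_mkcond; apply: eq_integral => x _.
  rewrite /oscillation !patchE; case: ifP => // _.
  by rewrite normr0 powR0// gt_eqF.
have mo : measurable_fun setT (oscillation c s).
  apply: measurable_restr; first exact: ballM.
  by apply: measurable_funB => //; exact: measurable_bmo.
have oL : oscillation c s \in Lfun mu r'%:E.
  apply: (Lfun_intP mu _ r'0).2; split; first exact: mo.
  by rewrite eI; apply: le_lt_trans hI (ltry _).
split => //.
have : Lrnorm mu r' (oscillation c s) `^ r' <= m * N `^ r'.
  by rewrite -lee_fin (Lrnorm_powR r'0 oL) eI; exact: hI.
move=> h; have := @ge0_ler_powR _ r'^-1 _ _ _ _ _ h.
rewrite invr_ge0 (ltW r'0) !nnegrE powR_ge0 => /(_ isT isT).
rewrite mulr_ge0 ?powR_ge0 ?(ltW m0)// => /(_ isT).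
rewrite powRM ?powR_ge0 ?(ltW m0)// -!powRrM mulfV ?gt_eqF//.
by rewrite !powRr1 ?Lrnorm_ge0// mulrC.
Qed.

Definition clipped_pairing (n : nat) (g : M -> R) : R :=
  \int[mu]_x (clip n (f x) * g x).

Lemma clipped_integrable (n : nat) (g : M -> R) : mu.-integrable setT (EFin \o g) ->
  mu.-integrable setT (EFin \o (fun x => clip n (f x) * g x)).
Proof.
move=> ig; have mc : measurable_fun setT (clip n \o f).
  by apply: measurable_clip; exact: measurable_bmo.
have := @integrableMr _ _ _ mu setT measurableT (clip n \o f) (EFin \o g) mc _ ig.
apply; exists n%:R; split; first exact: num_real.
by move=> l nl x _ /=; exact: le_trans (clip_le n (f x)) (ltW nl).
Qed.

Lemma clipped_pairing_ae (n : nat) (g h : M -> R) :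
  mu.-integrable setT (EFin \o g) -> mu.-integrable setT (EFin \o h) ->
  {ae mu, forall x, g x = h x} -> clipped_pairing n g = clipped_pairing n h.
Proof.
move=> ig ih gh; congr fine; apply: ae_eq_integral => //.
- exact: measurable_int (clipped_integrable n ig).
- exact: measurable_int (clipped_integrable n ih).
- by apply: filterS gh => x -> _.
Qed.

Lemma clipped_pairing_lin (n : nat) (t : R) (g h : M -> R) :
  mu.-integrable setT (EFin \o g) -> mu.-integrable setT (EFin \o h) ->
  clipped_pairing n (fun x => t * g x + h x) =
  t * clipped_pairing n g + clipped_pairing n h.
Proof.
move=> ig ih; have cg := clipped_integrable n ig; have ch := clipped_integrable n ih.
rewrite /clipped_pairing -RintegralZl// -RintegralD//; last exact: (integrableZl _ t cg).
by apply: eq_Rintegral => x _; rewrite mulrDr mulrCA.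
Qed.

(* Subtracting the constant clip n f_B and using that clip n is 1-Lipschitz
   bounds the pairing by the oscillation of f itself. *)
Lemma clipped_pairing_atom (n : nat) (a : M -> R) : atom_le mu b r a ->
  `|clipped_pairing n a| <= N.
Proof.
move=> [c [s [sb atom_a]]]; have s0 : 0 < s by case/andP: sb.
have [ia _ _ _] := atom_a.
have [aL a0 ia0 aa' aN] := atom_restr r_gt1 conj_rr' ball_gt0 ball_fin s0 atom_a.
set a' := a \_ (ball c s) in aL a0 ia0 aa' aN.
have ia' := (supp_Lfun_integrable r_gt1 conj_rr' (ballM c s) (ball_fin c s0) aL a0).1.
rewrite (clipped_pairing_ae n ia ia' aa').
pose k := clip n (average mu (ball c s) f).
have ick := clipped_integrable n ia'.
have -> : clipped_pairing n a' = \int[mu]_x (clip n (f x) * a' x - k * a' x).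
  rewrite RintegralB//; last exact: (integrableZl _ k ia').
  by rewrite RintegralZl// ia0 mulr0 subr0.
have idiff : mu.-integrable setT (EFin \o (fun x => clip n (f x) * a' x - k * a' x)).
  exact: (integrableB measurableT ick (integrableZl measurableT k ia')).
have [oL oN] := oscillation_Lfun c sb.
have [ioa hoa] := hoelder_int r'0 r0 conj_r'r oL aL.
apply: le_trans (le_normr_Rintegral measurableT idiff) _.
apply: (@le_trans _ _ (\int[mu]_x `|oscillation c s x * a' x|)).
  apply: le_Rintegral => //.
  - exact: integrable_norm idiff.
  - exact: integrable_norm ioa.
  - move=> x _; rewrite -mulrBl !normrM.
    have [Bx|Bx] := pselect (ball c s x); last by rewrite a0// normr0 !mulr0.
    by rewrite /oscillation patchE mem_set// ler_wpM2r// clip_lipschitz.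
apply: le_trans hoa _; apply: le_trans (ler_wpM2r (Lrnorm_ge0 _ _ _) oN) _.
rewrite -mulrA -[leRHS]mulr1 ler_wpM2l// mulrC; exact: aN.
Qed.

(** For fixed [n] the clipped function is bounded, so the pairing passes to the L^1 limit of the
    partial sums. The height [n] affects only how far the sum must be taken, not the final bound. *)
Lemma clipped_pairing_decomposition (n : nat) (g : M -> R) (lam : nat -> R)
    (a : nat -> M -> R) (A : R) :
  mu.-integrable setT (EFin \o g) -> atomic_decomposition mu b r g lam a ->
  (\sum_(0 <= k <oo) (`|lam k|)%:E = A%:E)%E -> `|clipped_pairing n g| <= N * A.
Proof.
move=> ig [ha S D] SA.
pose P K x := \sum_(k < K) lam k * a k x.
have iP K : mu.-integrable setT (EFin \o P K) := integrable_comb K lam ha.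
have partial K : `|clipped_pairing n (P K)| <= N * A.
  have -> : clipped_pairing n (P K) = \sum_(k < K) lam k * clipped_pairing n (a k).
    rewrite /clipped_pairing -Rintegral_sum; last first.
      by move=> k; apply: clipped_integrable; exact: atom_integrable (ha k).
    by apply: eq_Rintegral => x _; rewrite mulr_sumr; apply: eq_bigr => k _; rewrite mulrCA.
  apply: le_trans (ler_norm_sum _ _ _) _.
  apply: (@le_trans _ _ (N * \sum_(k < K) `|lam k|)).
    rewrite mulr_sumr; apply: ler_sum => k _.
    by rewrite normrM mulrC ler_wpM2r// clipped_pairing_atom.
  rewrite ler_wpM2l// -lee_fin -SA -sumEFin -(big_mkord xpredT (fun k => (`|lam k|)%:E)).
  by apply: nneseries_lim_ge => k _; rewrite lee_fin.
apply/ler_addgt0Pr => e e0.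
(* The L^1 remainder will be multiplied by [n]; adding 1 keeps the denominator positive when [n] is
   0. *)
have ed : 0 < e / (n%:R + 1) by rewrite divr_gt0// ltr_wpDl.
have /fine_cvgP[[K1 _ fin] /cvgrPdist_lt/(_ _ ed) [K2 _ cv]] := D.
pose K := maxn K1 K2.
have {}fin := fin K (leq_maxl _ _); have {cv} := cv K (leq_maxr _ _).
rewrite /= sub0r normrN ger0_norm; last first.
  by apply: fine_ge0; apply: integral_ge0 => x _; rewrite lee_fin.
move=> cv.
have igP : mu.-integrable setT (EFin \o (fun x => g x - P K x)).
  exact: (integrableB measurableT ig (iP K)).
have -> : clipped_pairing n g =
    clipped_pairing n (P K) + clipped_pairing n (fun x => g x - P K x).
  rewrite -[X in X + _]mul1r -clipped_pairing_lin//; congr clipped_pairing.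
  by apply/funext => x; rewrite mul1r addrC subrK.
apply: le_trans (ler_normD _ _) _; apply: lerD => //.
apply: le_trans (le_normr_Rintegral measurableT (clipped_integrable n igP)) _.
apply: (@le_trans _ _ (\int[mu]_x (n%:R * `|g x - P K x|))).
  apply: le_Rintegral => //.
  - exact: integrable_norm (clipped_integrable n igP).
  - exact: (integrableZl _ _ (integrable_norm igP)).
  - by move=> x _; rewrite normrM ler_wpM2r// clip_le.
rewrite RintegralZl//; last exact: integrable_norm igP.
apply: (@le_trans _ _ (n%:R * (e / (n%:R + 1)))).
  by rewrite ler_wpM2l// ltW.
by rewrite mulrA ler_pdivrMr ?ltr_wpDl// mulrC ler_wpM2l ?(ltW e0)// lerDl.
Qed.

Lemma hardy_decomposition_lt (g : M -> R) (e : R) : hardy mu b r g -> 0 < e ->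
  exists h lam a A, [/\ hardy_norm mu b r g = h%:E, 0 <= h,
    atomic_decomposition mu b r g lam a,
    (\sum_(0 <= k <oo) (`|lam k|)%:E = A%:E)%E & A < h + e].
Proof.
move=> [ig [lam0 [a0 D0]]] e0.
have h0 : (0 <= hardy_norm mu b r g)%E.
  apply: le_ereal_inf_tmp => _ [lam [a [_ ->]]].
  by apply: nneseries_ge0 => k _ _; rewrite lee_fin.
have hoo : (hardy_norm mu b r g < +oo)%E.
  have [_ S _] := D0; apply: le_lt_trans S; apply: ereal_inf_lbound.
  by exists lam0, a0.
have hfin : hardy_norm mu b r g \is a fin_num by rewrite ge0_fin_numE.
have hE : hardy_norm mu b r g = (fine (hardy_norm mu b r g))%:E by rewrite fineK.
have lt : (hardy_norm mu b r g < (fine (hardy_norm mu b r g) + e)%:E)%E.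
  by rewrite [ltLHS]hE lte_fin ltrDl.
have [_ [lam [a [D ->]]] Alt] := ereal_inf_lt lt.
have A0 : (0 <= \sum_(0 <= k <oo) (`|lam k|)%:E)%E.
  by apply: nneseries_ge0 => k _ _; rewrite lee_fin.
have Afin : (\sum_(0 <= k <oo) (`|lam k|)%:E)%E \is a fin_num.
  by rewrite ge0_fin_numE//; case: D.
exists (fine (hardy_norm mu b r g)), lam, a, (fine (\sum_(0 <= k <oo) (`|lam k|)%:E)%E).
split => //; rewrite ?fineK// ?fine_ge0//.
by rewrite -lte_fin fineK.
Qed.

Lemma clipped_pairing_hardy (n : nat) (g : M -> R) : hardy mu b r g ->
  `|clipped_pairing n g| <= N * fine (hardy_norm mu b r g).
Proof.
move=> gh; apply/ler_addgt0Pr => e e0.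
have N1 : 0 < N + 1 by rewrite ltr_wpDl.
have [h [lam [a [A [hE h0 D SA Alt]]]]] := hardy_decomposition_lt gh (divr_gt0 e0 N1).
apply: le_trans (clipped_pairing_decomposition n gh.1 D SA) _; rewrite hE/=.
apply: le_trans (ler_wpM2l N0 (ltW Alt)) _.
rewrite mulrDr lerD2l mulrA ler_pdivrMr// mulrC ler_wpM2l ?(ltW e0)// lerDl//.
Qed.

(** The BMO norm controls [f] only on balls of radius at most [b], so the support of [g] is covered
    by finitely many b-balls. On each, [f] is its oscillation plus a constant and Hoelder applies;
    the sum of the absolute values over the cover is an integrable majorant. *)
Lemma bmo_bounded_Lr_integrable (n : nat) (g : M -> R) : bounded_Lr mu r n g ->
  mu.-integrable setT (EFin \o (fun x => f x * g x)).
Proof.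
move=> [gL g0].
have [xs cov] : exists xs : seq M, forall y, ball (point : M) n%:R y ->
    exists2 x, x \in xs & ball x b y.
  case: n g0 => [|n] _; first by exists [::] => y; rewrite ball_nat0.
  by apply: (ball_cover mu_gt0 ball_fin ldp).
have bb : 0 < b <= b by rewrite b_gt0 lexx.
have loc x : mu.-integrable setT (EFin \o (fun y => f y * g y) \_ (ball x b)).
  have mB := ballM x b.
  have [oL _] := oscillation_Lfun x bb.
  have [gBL _] := Lfun_restr r0 mB gL.
  have [i1 _] := hoelder_int r'0 r0 conj_r'r oL gBL.
  have i2 := (supp_Lfun_integrable r_gt1 conj_rr' mB (ball_fin x b_gt0) gBL _).1.
  have {}i2 : mu.-integrable setT (EFin \o g \_ (ball x b)).
    by apply: i2 => y By; rewrite patchE memNset.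
  have := integrableD measurableT i1
     (integrableZl measurableT (average mu (ball x b) f) i2).
  apply: eq_integrable => // y _ /=; rewrite /oscillation !patchE.
  case: ifP => _; rewrite -?EFinM -EFinD; congr EFin; first by rewrite mulrBl subrK.
  by rewrite !mulr0 addr0.
have isum : mu.-integrable setT
    (fun y => \sum_(x <- xs) `|((fun y => f y * g y) \_ (ball x b) y)%:E|)%E.
  by apply: integrable_sum => // x _; exact: integrable_abse (loc x).
apply: le_integrable isum => //.
  apply/measurable_EFinP/measurable_funM; first exact: measurable_bmo.
  exact: Lfun_meas gL.
move=> y _ /=; rewrite [leRHS]gee0_abs; last by apply: sume_ge0.
have [yn|yn] := pselect (ball (point : M) n%:R y); last first.
  by rewrite g0// mulr0 normr0; apply: sume_ge0.
have [x xxs xy] := cov y yn.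
rewrite (big_rem x)//= patchE mem_set// leeDl//.
by apply: sume_ge0.
Qed.

(** On finite combinations the clipped pairings converge in the ordinary sense: [|f g'|] is
    integrable and dominates them. *)
Lemma clipped_pairing_fin (g : M -> R) : hardy_fin mu r g ->
  exists2 I : R, (\int[mu]_x (f x * g x)%:E = I%:E)%E &
    clipped_pairing n g @[n --> \oo] --> I.
Proof.
move=> gf; have [ig [k [g' [g'b _ gg']]]] := hardy_fin_restr r_gt1 conj_rr' mu_gt0 ball_fin ldp gf.
have ifg' := bmo_bounded_Lr_integrable g'b.
have mf := measurable_bmo.
have mg : measurable_fun setT g by apply/measurable_EFinP; exact: measurable_int ig.
have eI : (\int[mu]_x (f x * g x)%:E = \int[mu]_x (f x * g' x)%:E)%E.
  apply: ae_eq_integral => //.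
  - exact/measurable_EFinP/measurable_funM.
  - exact: measurable_int ifg'.
  - by apply: filterS gg' => x -> _.
have fin := integrable_fin_num measurableT ifg'.
exists (\int[mu]_x (f x * g' x)); first by rewrite eI /Rintegral fineK.
have ig' := bounded_Lr_int r_gt1 conj_rr' ball_fin g'b.
under eq_fun do rewrite (clipped_pairing_ae _ ig ig' gg').
apply: fine_cvg; rewrite /Rintegral fineK//.
have [] // := @dominated_convergence _ _ _ mu _ measurableT
  (fun n x => (clip n (f x) * g' x)%:E) (fun x => (f x * g' x)%:E)
  (fun x => `|(f x * g' x)%:E|%E).
- by move=> n; exact: measurable_int (clipped_integrable n ig').
- exact: measurable_int ifg'.
- apply: aeW => x _; apply: cvg_EFin; first exact: nearW.
  by apply: cvgM; [exact: clip_cvg|exact: cvg_cst].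
- exact: integrable_abse ifg'.
- by apply: aeW => x n _; rewrite lee_fin !normrM ler_wpM2r// clip_norm_le.
Qed.

Theorem bmo_to_dual : exists l : (M -> R) -> R,
  [/\ hardy_linear mu b r l, hardy_bounded mu b r l,
      (forall g, hardy_fin mu r g -> (l g)%:E = (\int[mu]_x (f x * g x)%:E)%E) &
      (dual_norm mu b r l <= bmo_norm mu b r' f)%E].
Proof.
have [U [UU subU]] := ultraFilterLemma eventually_filter.
have PU : ProperFilter U := @ultra_proper _ _ UU.
pose S g n := clipped_pairing n g.
(* The pairings are bounded but a priori not convergent for g in H^1; a limit
   along a fixed ultrafilter is linear and depends only on g. *)
have cvS g : hardy mu b r g -> cvg (S g @ U).
  by move=> gh; apply: ultra_bounded_cvg => n; exact: clipped_pairing_hardy gh.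
pose l g : R := lim (S g @ U).
have l_bnd g : hardy mu b r g -> `|l g| <= N * fine (hardy_norm mu b r g).
  move=> gh; have /cvg_norm cn := cvS g gh.
  by apply: (cvgr_to_le cn); apply: nearW => n; exact: clipped_pairing_hardy.
have hfin g : hardy mu b r g -> exists2 h : R, hardy_norm mu b r g = h%:E & 0 <= h.
  by move=> gh; have [h [? [? [? [hE h0 _ _ _]]]]] := hardy_decomposition_lt gh ltr01; exists h.
exists l; split.
- split.
    move=> g h gh hh gae; rewrite /l; congr (lim (_ @ U)); apply/funext => n.
    exact: clipped_pairing_ae gh.1 hh.1 gae.
  move=> t g h gh hh; apply/cvg_lim => //.
  rewrite (_ : S _ = fun n => t * S g n + S h n); last first.
    by apply/funext => n; exact: clipped_pairing_lin gh.1 hh.1.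
  by apply: cvgD; [apply: cvgM; [exact: cvg_cst|exact: cvS]|exact: cvS].
- exists N => g gh; have [h hE h0] := hfin g gh.
  by have := l_bnd g gh; rewrite hE /= -lee_fin EFinM.
- move=> g gf; have [I -> cI] := clipped_pairing_fin gf; congr EFin.
  (* [U] refines the filter of eventual statements, so an ordinary limit is also the limit along
     [U]. *)
  by apply/cvg_lim => //; apply: cvg_trans cI; apply: cvg_app; exact: subU.
- rewrite bmo_normE; apply: ub_ereal_sup => _ [g [gh g1] <-].
  have [h hE h0] := hfin g gh; rewrite lee_fin.
  apply: le_trans (l_bnd g gh) _; rewrite hE/= ler_piMr//.
  by move: g1; rewrite hE lee_fin.
Qed.

End bmo_functional.

Theorem theorem6p1 (R : realType) (d : measure_display)
  (M : borelMetricType d R) (mu : {measure set M -> \bar R})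
  (unboundedM : ~ metric_bounded [set: M])
  (mu_gt0 : (0 < mu [set: M])%E)
  (mu_ball_fin : forall (c : M) (s : R), 0 < s -> (mu (ball c s) < +oo)%E)
  (ldp : local_doubling mu)
  (isop : isoperimetric mu)
  (R0 beta : R) (R0_ge0 : 0 <= R0) (beta_bounds : 1 / 2 < beta < 1)
  (amp : approx_midpoint M R0 beta)
  (b0 : R) (b0_gt : R0 / (1 - beta) < b0)
  (r r' : R) (r_gt1 : 1 < r) (conj_rr' : r^-1 + r'^-1 = 1) :
  (forall f : M -> R, bmo mu b0 r' f ->
    exists l : (M -> R) -> R,
      [/\ hardy_linear mu b0 r l,
          hardy_bounded mu b0 r l,
          (forall g, hardy_fin mu r g ->
             (l g)%:E = (\int[mu]_x (f x * g x)%:E)%E) &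
          (dual_norm mu b0 r l <= bmo_norm mu b0 r' f)%E]) /\
  (exists C : R, forall l : (M -> R) -> R,
    hardy_linear mu b0 r l -> hardy_continuous mu b0 r l ->
    exists fl : M -> R,
      [/\ bmo mu b0 r' fl,
          (bmo_norm mu b0 r' fl <= C%:E * dual_norm mu b0 r l)%E &
          forall g, hardy_fin mu r g ->
            (l g)%:E = (\int[mu]_x (fl x * g x)%:E)%E]).
Proof.
have [beta12 beta1] := andP beta_bounds.
have beta01 : 0 < beta < 1 by apply/andP; split; lra.
have R0b : R0 < b0.
  (* As [0 < 1 - beta <= 1], dividing [R0] by it does not decrease it. *)
  apply: le_lt_trans b0_gt; rewrite ler_pdivlMr ?subr_gt0//.
  by rewrite ler_piMr//; lra.
split.
  move=> f bmo_f.
  by apply: (bmo_to_dual r_gt1 conj_rr' mu_gt0 mu_ball_fin ldp _ bmo_f); lra.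
exists 2 => l l_lin l_cont.
exact: (dual_to_bmo r_gt1 conj_rr' mu_gt0 mu_ball_fin ldp beta01 R0_ge0 R0b amp).
Qed.
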